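(* Let $T>0$, $d\in\mathbb{N}$, $x_0\in\mathbb{R}^d$, let $\pi$ be a partition of $[0,T]$, let $0\le\alpha'<\alpha\le1$, $\beta>0$, $\gamma\ge1$, and let $1\le p<\infty$. (i) Let $\nu$ be a finite measure on $(\widehat{\mathcal C}^\pi,\mathcal B(\widehat{\mathcal C}^\pi))$, let $\psi(\widehat X^\pi):=\exp(\beta\|\widehat X^\pi\|_\alpha^\gamma)$ for $\widehat X^\pi\in\widehat{\mathcal C}^\pi$, and assume $\int_{\widehat{\mathcal C}^\pi}\psi^p\,d\nu<\infty$. Let $$\mathcal L:=\Bigl\{f_\ell\colon\widehat{\mathcal C}^\pi\to\mathbb{R},\ \widehat X^\pi\mapsto\sum_{|I|\le N}\ell_I\langle e_I,\widehat{\mathbb X}^\pi_T\rangle\ :\ \ell_I\in\mathbb{R},\ N\in\mathbb{N}_0\Bigr\}.$$ Then for every $f\in L^p(\widehat{\mathcal C}^\pi;\nu)$ and every $\varepsilon>0$ there exists $f_\ell\in\mathcal L$ such that $\|f-f_\ell\|_{L^p(\widehat{\mathcal C}^\pi;\nu)}<\varepsilon$. (ii) Let $\nu$ be a finite measure on $(\Lambda_T^\pi,\mathcal B(\Lambda_T^\pi))$, let $\psi(\widehat X^\pi_{[0,t]}):=\exp(\beta\|\widehat X^{\pi,t}\|_\alpha^\gamma)$ for $\widehat X^\pi_{[0,t]}\in\Lambda^\pi_T$, and assume $\int_{\Lambda_T^\pi}\psi^p\,d\nu<\infty$. Let $$\mathcal L_\Lambda:=\Bigl\{f_\ell\colon\Lambda_T^\pi\to\mathbb{R},\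 \widehat X^\pi_{[0,t]}\mapsto\sum_{|I|\le N}\ell_I\langle e_I,\widehat{\mathbb X}^\pi_t\rangle\ :\ \ell_I\in\mathbb{R},\ N\in\mathbb{N}_0\Bigr\}.$$ Then for every $f\in L^p(\Lambda_T^\pi;\nu)$ and every $\varepsilon>0$ there exists $f_\ell\in\mathcal L_\Lambda$ such that $\|f-f_\ell\|_{L^p(\Lambda_T^\pi;\nu)}<\varepsilon$.
   Context: Path space. Let $\pi=\{0=t_0<\cdots<t_n=T\}$ be a partition of $[0,T]$ and $x_0\in\mathbb{R}^d$ a fixed initial value. For $X\colon\pi\to\mathbb{R}^d$ with $X_0=x_0$, $X^\pi\colon[0,T]\to\mathbb{R}^d$ is its piecewise linear interpolation, $X^\pi_t=X_{t_k}+\frac{t-t_k}{t_{k+1}-t_k}(X_{t_{k+1}}-X_{t_k})$ for $t\in[t_k,t_{k+1}]$, and $\widehat X^\pi_t=(t,X^\pi_t)\in\mathbb{R}^{d+1}$ is the time-extended path. $\widehat{\mathcal C}^\pi$ denotes the set of all such $\widehat X^\pi$. Norms. With $|\cdot|$ the Euclidean norm and $Y_{s,t}:=Y_t-Y_s$, set $\|Y\|_\alpha:=\sup_{0\le s<t\le T}\frac{|Y_{s,t}|}{|t-s|^\alpha}$ and $d_{\alpha'}(Y,Z):=\sup_{0\le s<t\le T}\frac{|Y_{s,t}-Z_{s,t}|}{|t-s|^{\alpha'}}$. $\widehat{\mathcal C}^\pi$ carries the metric $d_{\alpha'}$. Stopped paths. $\Lambda_T^\pi:=\bigcup_{t\in[0,T]}\{\widehat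 X^\pi_{[0,t]}:\widehat X^\pi\in\widehat{\mathcal C}^\pi\}$, where $\widehat X^\pi_{[0,t]}$ is the restriction of $\widehat X^\pi$ to $[0,t]$. For $\widehat X^\pi_{[0,t]}\in\Lambda_T^\pi$, $\widehat X^{\pi,t}\colon[0,T]\to\mathbb{R}^{d+1}$ is the path $\widehat X^{\pi,t}_u=(u,X^\pi_{u\wedge t})$. $\Lambda_T^\pi$ carries the metric $d_{\Lambda,\alpha'}(\widehat X^\pi_{[0,t]},\widehat Y^\pi_{[0,s]}):=|t-s|+d_{\alpha'}(\widehat X^{\pi,t},\widehat Y^{\pi,s})$. $\mathcal B(\cdot)$ denotes the Borel $\sigma$-algebra of the respective metric space. Signature. The coordinates of $\mathbb{R}^{d+1}$ are indexed by $0,1,\ldots,d$, with index $0$ the time coordinate, and $e_0,\dots,e_d$ is the canonical basis. Multi-indices $I=(i_1,\ldots,i_k)$ have entries in $\{0,\ldots,d\}$, $|I|=k$, $e_I=e_{i_1}\otimes\cdots\otimes e_{i_k}$. $\widehat{\mathbb X}^\pi_t$ is the signature of $\widehat X^\pi$ on $[0,t]$, i.e. the element of $T((\mathbb{R}^{d+1}))=\prod_{k\ge0}(\mathbb{R}^{d+1})^{\otimes k}$ with coordinates $\langle e_I,\widehat{\mathbb X}^\pi_t\rangle=\int_{0<u_1<\cdots<u_k<t}d\widehat X^{\pi,i_1}_{u_1}\cdots d\widehat X^{\pi,i_k}_{u_k}$ (Riemann–Stieltjes integrals), and $\langle e_\emptyset,\widehat{\mathbb X}^\pi_t\rangle=1$.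 *)

(* Defs.v *)
From HB Require Import structures.
From mathcomp Require Import all_boot all_order all_algebra.
From mathcomp Require Import all_classical all_reals all_analysis.
From mathcomp Require Import ring.

Set Implicit Arguments.
Unset Strict Implicit.
Unset Printing Implicit Defensive.
Import Order.TTheory GRing.Theory Num.Theory.
Import numFieldNormedType.Exports.

Local Open Scope classical_set_scope.
Local Open Scope ring_scope.

Section EuclideanNorm.
Context {R : realType} {m : nat}.
Implicit Types u v : 'rV[R]_m.

(* The library's norm on ['rV[R]_m] is the sup norm. *)
Definition enorm u : R := Num.sqrt (\sum_(i < m) u 0 i ^+ 2).

Lemma enorm_ge0 u : 0 <= enorm u.
Proof. exact: sqrtr_ge0. Qed.

Lemma enorm0 : enorm 0 = 0.
Proof.
by rewrite /enorm big1 ?sqrtr0// => i _; rewrite mxE expr0n.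
Qed.

Lemma enormN u : enorm (- u) = enorm u.
Proof. by rewrite /enorm; under eq_bigr do rewrite mxE sqrrN. Qed.

Lemma enorm_cauchy_schwarz u v :
  (\sum_(i < m) u 0 i * v 0 i) ^+ 2 <=
  (\sum_(i < m) u 0 i ^+ 2) * (\sum_(i < m) v 0 i ^+ 2).
Proof.
have lagrange : \sum_(i < m) \sum_(j < m) (u 0 i * v 0 j - u 0 j * v 0 i) ^+ 2 =
    2 * ((\sum_(i < m) u 0 i ^+ 2) * (\sum_(i < m) v 0 i ^+ 2) -
         (\sum_(i < m) u 0 i * v 0 i) ^+ 2).
  rewrite mulr_natl mulr2n.
  rewrite {1}[X in X - _]mulrC expr2 !big_distrlr /=.
  rewrite {1}exchange_big /= -!sumrB -big_split /=; apply: eq_bigr => i _.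
  rewrite -!sumrB -big_split /=; apply: eq_bigr => j _.
  ring.
rewrite -subr_ge0 -(@pmulr_rge0 _ 2)// -lagrange.
by apply: sumr_ge0 => i _; apply: sumr_ge0 => j _; exact: sqr_ge0.
Qed.

Lemma ler_enormD u v : enorm (u + v) <= enorm u + enorm v.
Proof.
rewrite -[leRHS]ger0_norm ?addr_ge0 ?enorm_ge0// -sqrtr_sqr ler_wsqrtr//.
have ge0 w : 0 <= \sum_(i < m) w 0 i ^+ 2 :> R.
  by apply: sumr_ge0 => i _; rewrite sqr_ge0.
rewrite sqrrD !sqr_sqrtr// -sqrtrM//.
have -> : \sum_(i < m) (u + v) 0 i ^+ 2 = \sum_(i < m) u 0 i ^+ 2 +
    (\sum_(i < m) u 0 i * v 0 i) *+ 2 + \sum_(i < m) v 0 i ^+ 2.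
  by rewrite -sumrMnl -!big_split; apply: eq_bigr => i _; rewrite mxE sqrrD.
rewrite lerD2r lerD2l lerMn2r /=.
by rewrite (le_trans (ler_norm _))// -sqrtr_sqr ler_wsqrtr// enorm_cauchy_schwarz.
Qed.

End EuclideanNorm.

Section HoelderNorm.
Context {R : realType} {m : nat}.
Implicit Types (T a : R) (Y Z : R -> 'rV[R]_m).
Local Open Scope ereal_scope.

(* Extended-real valued, so that no junk value arises when the supremum is
   infinite; it is finite on piecewise linear paths when [a <= 1]. *)
Definition holder_norm T a Y : \bar R :=
  ereal_sup [set (enorm (Y st.2 - Y st.1) / (`|st.2 - st.1| `^ a))%:E
            | st in [set st : R * R | [/\ 0 <= st.1, st.1 < st.2 & st.2 <= T]%R]].

Definition holder_dist T a Y Z : \bar R := holder_norm T a (Y \- Z)%R.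

Lemma holder_dist_refl T a Y : holder_dist T a Y Y <= 0.
Proof.
apply: ge_ereal_sup => _ [st _ <-].
by rewrite /= !subrr enorm0 mul0r.
Qed.

Lemma holder_dist_sym T a Y Z : holder_dist T a Y Z = holder_dist T a Z Y.
Proof.
congr ereal_sup; apply: eq_imagel => st _ /=.
rewrite -enormN; congr (enorm _ / _)%:E.
by apply/rowP => i; rewrite !mxE; ring.
Qed.

Lemma holder_dist_triangle T a X Y Z :
  holder_dist T a X Z <= holder_dist T a X Y + holder_dist T a Y Z.
Proof.
apply: ge_ereal_sup => _ [st stT <-].
apply: (@le_trans _ _ (
    (enorm ((X \- Y)%R st.2 - (X \- Y)%R st.1) / (`|st.2 - st.1| `^ a))%:E +
    (enorm ((Y \- Z)%R st.2 - (Y \- Z)%R st.1) / (`|st.2 - st.1| `^ a))%:E)).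
  rewrite -EFinD lee_fin -mulrDl ler_wpM2r ?invr_ge0 ?powR_ge0//.
  rewrite (le_trans _ (ler_enormD _ _))// le_eqVlt; apply/orP; left; apply/eqP.
  by congr enorm; apply/rowP => i; rewrite !mxE; ring.
by apply: leeD; apply: ereal_sup_ubound; exists st.
Qed.

Lemma holder_dist_lt T a X Y Z (e1 e2 : R) :
  holder_dist T a X Y < e1%:E -> holder_dist T a Y Z < e2%:E ->
  holder_dist T a X Z < (e1 + e2)%:E.
Proof.
move=> XY YZ; apply: (le_lt_trans (holder_dist_triangle T a X Y Z)).
by rewrite EFinD lteD.
Qed.

End HoelderNorm.

Section Paths.
Context {R : realType} {d : nat}.
Implicit Types (T a t : R) (ts : seq R).

(* A partition 0 = t_0 < t_1 < ... < t_n = T is the list [ts] of t_1, ..., t_n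
   with [itv_partition 0 T ts], so that t_k is [(0 :: ts)`_k] and t_(k+1) is
   [ts`_k]. Only the values of [X] at these points are used. The [find] selects
   the first k such that t <= t_(k+1); see [interpolateE]. *)
Definition interpolate ts (X : R -> 'rV[R]_d) t : 'rV[R]_d :=
  let k := find (fun u => t <= u) ts in
  let tk := (0 :: ts)`_k in
  let tk1 := ts`_k in
  X tk + ((t - tk) / (tk1 - tk)) *: (X tk1 - X tk).

Lemma interpolateE (T : R) (ts : seq R) (X : R -> 'rV[R]_d) (k : nat) (t : R) :
  itv_partition 0 T ts -> (k < size ts)%N -> (0 :: ts)`_k <= t <= ts`_k ->
  interpolate ts X t = X (0 :: ts)`_k +
    ((t - (0 :: ts)`_k) / (ts`_k - (0 :: ts)`_k)) *:
    (X ts`_k - X (0 :: ts)`_k).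
Proof.
move=> [pts _] ks /andP[t1 t2].
have incr i : (i < size ts)%N -> (0 :: ts)`_i < ts`_i by move/(pathP 0) : pts; apply.
have step i : (i < size ts)%N -> find (fun u : R => t <= u) ts = i ->
   interpolate ts X t = X (0 :: ts)`_i + ((t - (0 :: ts)`_i) / (ts`_i - (0 :: ts)`_i)) *:
    (X ts`_i - X (0 :: ts)`_i) by move=> _ <-.
have sts : sorted <=%R ts.
  by apply: (@sub_sorted _ <%R); [move=> u v /ltW|exact: path_sorted pts].
have nth_le i j : (i <= j)%N -> (j < size ts)%N -> ts`_i <= ts`_j.
  move=> ij js; apply: (@sorted_leq_nth _ <=%R le_trans lexx 0 _ sts) => //.
  by rewrite inE (leq_ltn_trans ij).
have hasT : has (fun u : R => t <= u) ts by apply/hasP; exists ts`_k => //; exact: mem_nth.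
have fk : (find (fun u : R => t <= u)%R ts <= k)%N.
  by rewrite leqNgt; apply/negP => /(before_find 0); rewrite t2.
have := nth_find 0 hasT; set f := find _ _ in fk *.
move: fk; rewrite leq_eqVlt => /orP[/eqP fk _|fk tf]; first exact: step.
case: k => [//|k] in ks t1 t2 fk *.
have tE : t = ts`_k.
  apply/eqP; rewrite eq_le t1 andbT (le_trans tf)// nth_le// ltnW//.
have kf : f = k.
  apply/eqP; rewrite eqn_leq -ltnS fk /= leqNgt; apply/negP => fk'.
  case: k => [//|k] in ks t1 t2 fk tE fk' *.
  have := le_lt_trans (nth_le f k fk' (ltnW (ltnW ks))) (incr k.+1 (ltnW ks)).
  by rewrite -tE ltNge tf.
rewrite (step k (ltnW ks) kf) /= -tE subrr mul0r scale0r addr0.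
rewrite divff ?scale1r; first by rewrite addrC subrK.
by rewrite subr_eq0 tE gt_eqF// incr// ltnW.
Qed.

Definition time_extend (X : R -> 'rV[R]_d) t : 'rV[R]_(1 + d) :=
  row_mx t%:M (X t).

(* A function on an interval [0, t] is encoded as a function on R that vanishes
   outside of [0, t], so that equality is equality on [0, t]. Coordinate 0 of
   ['rV_(1 + d)] is time. *)
Definition path_set T (x0 : 'rV[R]_d) ts : set (R -> 'rV[R]_(1 + d)) :=
  [set Y | exists2 X : R -> 'rV[R]_d, X 0 = x0 &
    Y = patch (fun=> 0) `[0, T] (time_extend (interpolate ts X))].

(* A stopped path is the pair of its time t and of its restriction to [0, t]. *)
Definition stopped_set T (x0 : 'rV[R]_d) ts : set (R * (R -> 'rV[R]_(1 + d))) :=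
  [set w | 0 <= w.1 <= T /\
    exists2 Y, path_set T x0 ts Y & w.2 = patch (fun=> 0) `[0, w.1] Y].

(* The path on the whole of [0, T] that is frozen after time [w.1], except for
   its time coordinate. *)
Definition stopped_path (w : R * (R -> 'rV[R]_(1 + d))) (u : R) :
    'rV[R]_(1 + d) :=
  row_mx u%:M (rsubmx (w.2 (Num.min u w.1))).

Definition stopped_dist T a (w v : R * (R -> 'rV[R]_(1 + d))) : \bar R :=
  (`|w.1 - v.1|%:E + holder_dist T a (stopped_path w) (stopped_path v))%E.

Lemma path_set_nonempty T x0 ts : path_set T x0 ts !=set0.
Proof.
by exists (patch (fun=> 0) `[0, T] (time_extend (interpolate ts (cst x0)))), (cst x0).
Qed.

Lemma stopped_set_nonempty (T : {posnum R}) x0 ts :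
  stopped_set T%:num x0 ts !=set0.
Proof.
have [Y YT] := path_set_nonempty T%:num x0 ts.
exists (0, patch (fun=> 0) `[0, 0] Y); split; first by rewrite /= lexx ge0.
by exists Y.
Qed.

Lemma stopped_dist_refl T a w : (stopped_dist T a w w <= 0)%E.
Proof. by rewrite /stopped_dist subrr normr0 add0e holder_dist_refl. Qed.

Lemma stopped_dist_sym T a w v : stopped_dist T a w v = stopped_dist T a v w.
Proof. by rewrite /stopped_dist distrC holder_dist_sym. Qed.

Lemma stopped_dist_lt T a u v w (e1 e2 : R) :
  (stopped_dist T a u v < e1%:E)%E -> (stopped_dist T a v w < e2%:E)%E ->
  (stopped_dist T a u w < (e1 + e2)%:E)%E.
Proof.
move=> uv vw; rewrite EFinD; apply: le_lt_trans (lteD uv vw).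
rewrite /stopped_dist addeACA; apply: leeD; last exact: holder_dist_triangle.
by rewrite -EFinD lee_fin ler_distD.
Qed.

End Paths.

(* The parameter [a] does not occur in the carrier: it selects the exponent of
   the metric. Since distances are extended reals, the metric topologies are
   given through their balls, as [pseudoMetricType] instances. *)
Definition path_space (R : realType) (d : nat) (T : {posnum R})
    (x0 : 'rV[R]_d) (ts : seq R) (a : R) : Type :=
  set_type (path_set T%:num x0 ts).

Definition stopped_space (R : realType) (d : nat) (T : {posnum R})
    (x0 : 'rV[R]_d) (ts : seq R) (a : R) : Type :=
  set_type (stopped_set T%:num x0 ts).

Section PathSpaceMetric.
Context {R : realType} {d : nat}.
Variables (T : {posnum R}) (x0 : 'rV[R]_d) (ts : seq R) (a : R).
Local Notation S := (path_space T x0 ts a).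

Let dist (Y Z : S) := holder_dist T%:num a (sval Y) (sval Z).
Let pball (Y : S) (e : R) : set S := [set Z | (dist Y Z < e%:E)%E].

HB.instance Definition _ := Choice.on S.
HB.instance Definition _ := isPointed.Build S
  (exist (fun Y => Y \in _) _ (mem_set (projT2 (cid (path_set_nonempty T%:num x0 ts))))).
HB.instance Definition _ := hasNbhs.Build S (nbhs_ (entourage_ pball)).

Let pball_center (Y : S) (e : R) : 0 < e -> pball Y e Y.
Proof. by move=> e0; apply: (le_lt_trans (holder_dist_refl _ _ _)). Qed.

Let pball_sym (Y Z : S) (e : R) : pball Y e Z -> pball Z e Y.
Proof. by rewrite /pball /dist /= holder_dist_sym. Qed.

Let pball_triangle (X Y Z : S) (e1 e2 : R) :
  pball X e1 Y -> pball Y e2 Z -> pball X (e1 + e2) Z.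
Proof. exact: holder_dist_lt. Qed.

HB.instance Definition _ := @Nbhs_isPseudoMetric.Build R S (entourage_ pball)
  erefl pball pball_center pball_sym pball_triangle erefl.

End PathSpaceMetric.

Section StoppedSpaceMetric.
Context {R : realType} {d : nat}.
Variables (T : {posnum R}) (x0 : 'rV[R]_d) (ts : seq R) (a : R).
Local Notation S := (stopped_space T x0 ts a).

Let dist (w v : S) := stopped_dist T%:num a (sval w) (sval v).
Let sball (w : S) (e : R) : set S := [set v | (dist w v < e%:E)%E].

HB.instance Definition _ := Choice.on S.
HB.instance Definition _ := isPointed.Build S
  (exist (fun w => w \in _) _ (mem_set (projT2 (cid (stopped_set_nonempty T x0 ts))))).
HB.instance Definition _ := hasNbhs.Build S (nbhs_ (entourage_ sball)).

Let sball_center (w : S) (e : R) : 0 < e -> sball w e w.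
Proof. by move=> e0; apply: (le_lt_trans (stopped_dist_refl _ _ _)). Qed.

Let sball_sym (w v : S) (e : R) : sball w e v -> sball v e w.
Proof. by rewrite /sball /dist /= stopped_dist_sym. Qed.

Let sball_triangle (u v w : S) (e1 e2 : R) :
  sball u e1 v -> sball v e2 w -> sball u (e1 + e2) w.
Proof. exact: stopped_dist_lt. Qed.

HB.instance Definition _ := @Nbhs_isPseudoMetric.Build R S (entourage_ sball)
  erefl sball sball_center sball_sym sball_triangle erefl.

End StoppedSpaceMetric.

(* The measurable type of [S] with its Borel sigma-algebra. *)
Notation borel S := (g_sigma_algebraType (@open S)).

Section Signature.
Context {R : realType} {m : nat}.
Implicit Types (f g : R -> R) (a b t : R) (Y : R -> 'rV[R]_m) (I : seq 'I_m).

(* Riemann-Stieltjes sums and integral of [f] against [g], with tags [xi]. *)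
Definition RS_sum f g a (s : seq R) (xi : nat -> R) : R :=
  \sum_(k < size s) f (xi k) * (g s`_k - g (a :: s)`_k).

Definition is_RS_integral f g a b (v : R) : Prop :=
  forall eps : R, 0 < eps -> exists2 delta : R, 0 < delta &
    forall (s : seq R) (xi : nat -> R), itv_partition a b s ->
      (forall k, (k < size s)%N ->
        s`_k - (a :: s)`_k < delta /\ (a :: s)`_k <= xi k <= s`_k) ->
      `|RS_sum f g a s xi - v| < eps.

Definition RS_integral f g a b : R := get [set v | is_RS_integral f g a b v].

(* Words are read from the outermost integral inwards, hence the [rev] in
   [signature], where the last letter is integrated last. *)
Fixpoint iterated_integral Y I t : R :=
  if I is i :: I' then
    RS_integral (iterated_integral Y I') (fun u => Y u 0 i) 0 t
  else 1.

(* The coordinate of index [I] of the signature of [Y] on [0, t]. *)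
Definition signature Y t I : R := iterated_integral Y (rev I) t.

Definition signature_functional (N : nat) (l : seq 'I_m -> R) Y t : R :=
  \sum_(k < N.+1) \sum_(I : k.-tuple 'I_m) l I * signature Y t I.

End Signature.

Section Functionals.
Context {R : realType} {d : nat}.
Variables (T : {posnum R}) (x0 : 'rV[R]_d) (ts : seq R) (a : R).

Definition path_functionals : set (path_space T x0 ts a -> R) :=
  [set f | exists N l,
    f = fun Y => signature_functional N l (sval Y) T%:num].

Definition stopped_functionals : set (stopped_space T x0 ts a -> R) :=
  [set f | exists N l,
    f = fun w => signature_functional N l (sval w).2 (sval w).1].

End Functionals.

Definition exp_weight (R : realType) (m : nat) (T : {posnum R})
    (alpha beta gamma : R) (Y : R -> 'rV[R]_m) : \bar R :=
  expeR (beta%:E * holder_norm T%:num alpha Y `^ gamma)%E.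

(* Main.v *)
Require Import Defs.
From HB Require Import structures.
From mathcomp Require Import all_boot all_order all_algebra.
From mathcomp Require Import all_classical all_reals all_analysis.
From mathcomp Require Import measurable_realfun.
From mathcomp Require Import ring lra.

Set Implicit Arguments.
Unset Strict Implicit.
Unset Printing Implicit Defensive.
Import Order.TTheory GRing.Theory Num.Theory.
Import numFieldNormedType.Exports.
Import HBSimple HBNNSimple.

Local Open Scope classical_set_scope.
Local Open Scope ring_scope.

(** A stopped path is determined by its stopping time and by its slopes on the
    intervals of the partition; a path on the whole interval is the case where
    the stopping time is T. Coordinates of the
    signature are iterated Stieltjes integrals of such a path. The shuffle
    identity [iterated_integralM] makes their linear combinations an algebra
    of functions, and it remains to see why this algebra is dense in L^p.

    The density is a statement of moment-problem type, and it is proved without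
    compactness or duality. Call a bounded function b a multiplier if b h is an
    L^p limit of the algebra for every h in the algebra. Multipliers are stable
    under products, sums and bounded pointwise limits, hence the sets with a
    multiplier as indicator form a sigma-algebra, and every bounded function
    that is measurable for it is a multiplier. If g belongs to the algebra and
    is dominated by a function V whose exponential is p-integrable, the Taylor
    series of sin (g / n) converges in L^p after multiplication by any h of
    subexponential growth in V, so sin (g / n) is a multiplier for large n, and
    g, the limit of n sin (g / n), is measurable for that sigma-algebra. When
    such functions g generate all measurable sets, every bounded measurable
    function is a multiplier; multiplying it by 1 and truncating gives density
    ([generated_algebra_dense]).

    Two facts about paths feed this argument. For the growth, a word of length
    k is at most the k-th power of the total variation
    ([iterated_integral_le]), and the total variation is at most a constant
    times the Hoelder norm ([slope_variation_holder]) because there are finitely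
    many intervals; so for gamma >= 1 the weight controls the exponential of a
    multiple of the variation ([expR_variation_le_weight]). For the generation,
    the functions g are the words with one arbitrary letter integrated against
    powers of time, that is, the moments of the path. Integrating polynomials
    that converge to the indicator of [0, u] recovers the values of the stopped
    path from the moments, difference quotients of the values recover the
    slopes, and an open set is a countable union of boxes in the stopping time
    and the slopes ([moments_generate]). The last point needs the exponent of
    the metric to be less than 1: a change of the stopping time then moves the
    stopped path by a small amount ([stopped_dist_lt_slopes]).

    The Riemann-Stieltjes integrals are handled through [stieltjes_primitive]:
    F is a primitive of f dg when the increments of F are f dg up to a quadratic
    error. Such errors vanish along fine partitions, which gives the values of
    the integrals ([RS_integral_primitive]) and, through [quadratic_control],
    the uniqueness of primitives, hence the shuffle identity, and the bound by
    the variation. *)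

(** * Integrals of p-th powers *)

Section PowerIntegral.
Context {d} {S : measurableType d} {R : realType}.
Variables (mu : {measure set S -> \bar R}) (p : R).
Hypothesis p1 : 1 <= p.
Implicit Types (f g : S -> R) (e c : R).

Definition power_integral f : \bar R := (\int[mu]_x (`|f x| `^ p)%:E)%E.

Let p0 : 0 <= p. Proof. exact: le_trans p1. Qed.
Let pgt0 : 0 < p. Proof. exact: lt_le_trans p1. Qed.

Lemma measurable_power_norm f : measurable_fun setT f ->
  measurable_fun setT (fun x => (`|f x| `^ p)%:E).
Proof.
move=> mf; apply/measurable_EFinP.
apply: (measurableT_comp (measurable_powR p)).
exact: (measurableT_comp (@normr_measurable R setT)).
Qed.

Lemma power_integral_ge0 f : (0 <= power_integral f)%E.
Proof. by apply: integral_ge0 => x _; rewrite lee_fin powR_ge0. Qed.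

Lemma le_power_integral f g : measurable_fun setT f -> measurable_fun setT g ->
  (forall x, `|f x| <= `|g x|) -> (power_integral f <= power_integral g)%E.
Proof.
move=> mf mg fg; apply: ge0_le_integral => //.
- exact: measurable_power_norm.
- exact: measurable_power_norm.
- by move=> x _; rewrite lee_fin ge0_ler_powR// nnegrE.
Qed.

Lemma power_integral_scale c f : measurable_fun setT f ->
  power_integral (fun x => c * f x) = ((`|c| `^ p)%:E * power_integral f)%E.
Proof.
move=> mf; rewrite -ge0_integralZl_EFin ?powR_ge0//; last first.
  exact: measurable_power_norm.
by apply: eq_integral => x _; rewrite normrM powRM// EFinM.
Qed.

(** The cheap substitute for Minkowski's inequality: a constant in front is
    harmless when only convergence to 0 matters. *)
Lemma power_integral_quasi_triangle f g : measurable_fun setT f -> measurable_fun setT g ->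
  (power_integral (f \+ g)%R <= (2 `^ p)%:E * (power_integral f + power_integral g))%E.
Proof.
move=> mf mg; rewrite -ge0_integralD//; last 2 first.
- exact: measurable_power_norm.
- exact: measurable_power_norm.
rewrite -ge0_integralZl_EFin ?powR_ge0//; last 2 first.
- by move=> x _; rewrite -EFinD lee_fin addr_ge0 ?powR_ge0.
- by apply: emeasurable_funD; exact: measurable_power_norm.
apply: ge0_le_integral => //.
- by apply: measurable_power_norm; exact: measurable_funD.
- apply/measurable_EFinP.
  apply: measurable_funM => //.
  by apply: measurable_funD; apply/measurable_EFinP; exact: measurable_power_norm.
move=> x _; rewrite -EFinD -EFinM lee_fin.
wlog gf : f g {mf mg} / `|g x| <= `|f x|.
  move=> h; have [gf|/ltW fg] := leP `|g x| `|f x|; first exact: h.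
  by rewrite /= addrC [X in _ * X]addrC; exact: (h g f fg).
apply: (@le_trans _ _ ((2 * `|f x|) `^ p)).
  rewrite ge0_ler_powR// ?nnegrE ?mulr_ge0//.
  by rewrite (le_trans (ler_normD _ _))// mulr_natl mulr2n lerD2l.
by rewrite powRM// ler_wpM2l ?powR_ge0// lerDl powR_ge0.
Qed.

(** Dominated convergence, in the only form that an approximation argument
    uses: some term of the sequence is as small as required. *)
Lemma power_integral_dominated (f_ : nat -> S -> R) g :
  (forall n, measurable_fun setT (f_ n)) -> measurable_fun setT g ->
  (forall x, f_ ^~ x @ \oo --> 0) -> (forall n x, `|f_ n x| <= g x) ->
  (power_integral g < +oo)%E -> forall e, 0 < e -> exists n, (power_integral (f_ n) < e%:E)%E.
Proof.
move=> mf mg f0 fg gfin e e0.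
have g0 x : 0 <= g x by rewrite (le_trans _ (fg 0%N x)).
have mgp := measurable_power_norm mg.
have : power_integral (f_ n) @[n --> \oo] --> (\int[mu]_x (cst 0 x))%E.
  apply: (@dominated_cvg _ _ _ mu _ _ _ _ (fun x => (`|g x| `^ p)%:E)) => //.
  - by move=> n; exact: measurable_power_norm.
  - move=> x _; apply: cvg_EFin; first by near=> n.
    rewrite /=; apply/cvgr0Pnorm_lt => eps eps0.
    have /cvgr0Pnorm_lt/(_ (eps `^ p^-1)) := f0 x.
    rewrite powR_gt0// => /(_ isT); apply: filterS => n /= fn.
    rewrite ger0_norm ?powR_ge0//.
    have -> : eps = (eps `^ p^-1) `^ p.
      by rewrite -powRrM mulVf ?gt_eqF// powRr1// ltW.
    by rewrite gt0_ltr_powR// nnegrE ?powR_ge0.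
  - apply/integrableP; split => //.
    under eq_integral do rewrite /= ger0_norm ?powR_ge0//.
    exact: gfin.
  - move=> n x _ /=; rewrite ger0_norm ?powR_ge0// lee_fin ge0_ler_powR// ?nnegrE//.
    by rewrite (le_trans (fg n x))// ler_norm.
rewrite integral0 => /fine_cvgP[/= [N1 _ fin] /cvgr0Pnorm_lt/(_ _ e0) [N2 _ lt]].
exists (maxn N1 N2).
rewrite -(fineK (fin (maxn N1 N2) (leq_maxl _ _))) lte_fin.
by apply: le_lt_trans (lt (maxn N1 N2) (leq_maxr _ _)); exact: ler_norm.
Unshelve. all: by end_near. Qed.

End PowerIntegral.

(** * Polynomial approximation of the absolute value *)

Section AbsolutePolynomials.
Context {R : realFieldType}.

(** The iteration of the classical proof that the absolute value is a limit of
    polynomials on [-1, 1]: the error at x is multiplied by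
    1 - (|x| + p_n(x)) / 2 at each step. *)
Fixpoint abs_poly n : {poly R} :=
  if n is n'.+1 then abs_poly n' + 2^-1 *: ('X ^+ 2 - abs_poly n' ^+ 2) else 0.

Lemma abs_poly_bounds n (x : R) : `|x| <= 1 ->
  0 <= (abs_poly n).[x] <= `|x| /\
  `|x| - (abs_poly n).[x] <= `|x| * (1 - `|x| / 2) ^+ n.
Proof.
move=> x1; elim: n => [|n [/andP[p0 px] IH]].
  by rewrite /= horner0 lexx normr_ge0 expr0 mulr1 subr0.
have E : (abs_poly n.+1).[x] = (abs_poly n).[x] + 2^-1 * (`|x| ^+ 2 - (abs_poly n).[x] ^+ 2).
  by rewrite /= hornerD hornerZ hornerD hornerN !horner_exp hornerX real_normK// num_real.
rewrite E [_ ^+ n.+1]exprS; set q := (abs_poly n).[x] in p0 px IH *; set y := `|x| in x1 px IH *.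
have y0 : 0 <= y by exact: normr_ge0.
set c := (1 - y / 2) ^+ n in IH *.
have y2 : 0 <= 1 - y / 2 by lra.
split; first by nra.
have -> : y - (q + 2^-1 * (y ^+ 2 - q ^+ 2)) = (y - q) * (1 - (y + q) / 2) by field.
apply: (@le_trans _ _ ((y - q) * (1 - y / 2))); first by nra.
by rewrite [_ * c]mulrC mulrA ler_wpM2r.
Qed.

End AbsolutePolynomials.

Lemma abs_poly_cvg (R : realType) (x : R) : `|x| <= 1 ->
  (abs_poly n).[x] @[n --> \oo] --> `|x|.
Proof.
move=> x1; have y0 := normr_ge0 x.
have [x0|xneq0] := eqVneq x 0.
  have E n : (abs_poly n).[x] = `|x|.
    have [/andP[p0 px] _] := abs_poly_bounds n x1.
    by apply/eqP; rewrite eq_le px x0 normr0 -[X in _.[X]]x0.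
  by under eq_fun do rewrite E; exact: cvg_cst.
have xgt0 : 0 < `|x| by rewrite normr_gt0.
pose lo n : R := `|x| - `|x| * (1 - `|x| / 2) ^+ n.
apply: (@squeeze_cvgr _ _ _ _ lo (cst `|x|)).
- near=> n; have [/andP[p0 px] err] := abs_poly_bounds n x1.
  by rewrite px andbT lerBlDr addrC -lerBlDr.
- rewrite -[X in _ --> X]subr0 -[X in _ --> _ - X](mulr0 `|x|).
  apply: cvgB; first exact: cvg_cst.
  apply: cvgM; first exact: cvg_cst.
  by apply: cvg_expr; rewrite ger0_norm; lra.
- exact: cvg_cst.
Unshelve. all: by end_near. Qed.

(** * Density of an algebra under exponential integrability *)

Lemma sin_scaled_cvg (R : realType) (x : R) :
  n.+1%:R * sin (n.+1%:R^-1 * x) @[n --> \oo] --> x.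
Proof.
pose f (y : R) := sin (y * x).
have D : is_derive (0 : R) 1 f x.
  have D1 : is_derive (0 : R) 1 (fun y => y * x) x.
    by apply: is_derive_eq; rewrite scaler0 add0r; exact: mulr1.
  have := @is_derive1_comp _ (@sin R) (fun y => y * x) 0 _ _ (is_derive_sin _) D1.
  by rewrite mul0r cos0 mul1r.
have quot : h^-1 *: ((f \o shift 0) (h *: (1 : R)) - f 0) @[h --> (0 : R)^'] --> x.
  have E : 'D_1 f (0 : R) = x by exact: derive_val.
  rewrite -[X in _ --> X]E.
  exact: (@ex_derive _ _ _ _ _ _ _ D).
have /cvgr_dnbhsP/(_ (fun n => n.+1%:R^-1)) := quot.
have -> : (fun n => n.+1%:R^-1^-1 *: ((f \o shift 0) (n.+1%:R^-1 *: (1 : R)) - f 0))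
    = (fun n => n.+1%:R * sin (n.+1%:R^-1 * x)).
  apply/funext => n.
  by rewrite /f /= mul0r sin0 subr0 invrK addr0 [_ *: 1]mulr1.
by apply; split=> [n|]; [rewrite invr_eq0 pnatr_eq0|exact: cvg_harmonic].
Qed.

Section Multipliers.
Context {d} {S : measurableType d} {R : realType}.
Variables (mu : {measure set S -> \bar R}) (p : R).
Hypothesis p1 : 1 <= p.
Variables (L : set (S -> R)) (V : S -> R).
Hypothesis L_measurable : forall h, L h -> measurable_fun setT h.
Hypothesis L_cst : forall c, L (cst c).
Hypothesis LD : forall h k, L h -> L k -> L (fun x => h x + k x).
Hypothesis LM : forall h k, L h -> L k -> L (fun x => h x * k x).
Hypothesis V_measurable : measurable_fun setT V.
Hypothesis V_ge0 : forall x, 0 <= V x.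
Hypothesis V_integrable : (power_integral mu p (expR \o V) < +oo)%E.
Hypothesis L_growth : forall h, L h -> forall e : R, 0 < e ->
  exists2 C : R, 0 <= C & forall x, `|h x| <= C * expR (e * V x).

Implicit Types (f g h b c : S -> R) (e a C K : R).

Let mexpV a : measurable_fun setT (fun x => a * expR (V x)).
Proof. by apply: measurable_funM => //; exact: measurableT_comp. Qed.

Lemma power_integral_growth_lty h C : measurable_fun setT h ->
  (forall x, `|h x| <= C * expR (V x)) -> (power_integral mu p h < +oo)%E.
Proof.
move=> mh hC; apply: (@le_lt_trans _ _ (power_integral mu p (fun x => C * expR (V x)))).
  by apply: le_power_integral => // x; rewrite (le_trans (hC x))// ler_norm.
rewrite power_integral_scale//; last exact: measurableT_comp.
by rewrite lte_mul_pinfty// lee_fin powR_ge0.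
Qed.

Lemma L_growth1 h : L h ->
  exists2 C, 0 <= C & forall x, `|h x| <= C * expR (V x).
Proof.
move=> /L_growth/(_ 1 ltr01)[C C0 hC]; exists C => // x.
by rewrite -[V x]mul1r.
Qed.

Definition approximable f := measurable_fun setT f /\
  forall e, 0 < e -> exists2 h, L h & (power_integral mu p (fun x => f x - h x)%R < e%:E)%E.

Lemma approximable_L h : L h -> approximable h.
Proof.
move=> Lh; split; first exact: L_measurable.
move=> e e0; exists h => //; rewrite /power_integral.
under eq_integral do rewrite subrr normr0 powR0 ?gt_eqF ?(lt_le_trans _ p1)//.
by rewrite integral0.
Qed.

Lemma power_integral_lt_quasi f g e : measurable_fun setT f -> measurable_fun setT g ->
  (power_integral mu p f < (e / (2 `^ p * 2))%:E)%E ->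
  (power_integral mu p g < (e / (2 `^ p * 2))%:E)%E ->
  (power_integral mu p (fun x => f x + g x)%R < e%:E)%E.
Proof.
set e' := e / _ => mf mg fe ge.
have := power_integral_quasi_triangle mu p1 mf mg.
move=> /le_lt_trans; apply.
have c0 : 0 < (2 : R) `^ p by rewrite powR_gt0.
have -> : e = 2 `^ p * (e' + e').
  by rewrite /e' -mulr2n -mulr_natr; field; rewrite gt_eqF.
rewrite (EFinM (2 `^ p)) (EFinD e' e').
by rewrite lte_pmul2l; [exact: lteD fe ge|by []|by rewrite lte_fin].
Qed.

Lemma approximable_closed f : measurable_fun setT f ->
  (forall e, 0 < e -> exists2 f', approximable f' &
     (power_integral mu p (fun x => f x - f' x)%R < e%:E)%E) -> approximable f.
Proof.
move=> mf H; split=> // e e0.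
have e'0 : 0 < e / (2 `^ p * 2) by rewrite divr_gt0// mulr_gt0// powR_gt0.
have [f' [mf' af'] ff'] := H _ e'0.
have [h Lh f'h] := af' _ e'0.
exists h => //; have mh := L_measurable Lh.
have -> : (fun x => f x - h x) = (fun x => (f x - f' x) + (f' x - h x)).
  by apply/funext => x; rewrite addrA subrK.
exact: (power_integral_lt_quasi (measurable_funB mf mf') (measurable_funB mf' mh) ff' f'h).
Qed.

Lemma approximableD f g : approximable f -> approximable g ->
  approximable (fun x => f x + g x).
Proof.
move=> [mf af] [mg ag]; split; first exact: measurable_funD.
move=> e e0.
have e'0 : 0 < e / (2 `^ p * 2) by rewrite divr_gt0// mulr_gt0// powR_gt0.
have [h Lh fh] := af _ e'0; have [k Lk gk] := ag _ e'0.
exists (fun x => h x + k x); first exact: LD.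
have mh := L_measurable Lh; have mk := L_measurable Lk.
have -> : (fun x => f x + g x - (h x + k x)) =
  (fun x => (f x - h x) + (g x - k x)).
  by apply/funext => x; rewrite opprD addrACA.
exact: (power_integral_lt_quasi (measurable_funB mf mh) (measurable_funB mg mk) fh gk).
Qed.

(** Products, sums and bounded pointwise limits stay in this class, whereas the
    unbounded elements of [L] have no stability under limits; this is what
    replaces a Stone-Weierstrass argument. *)
Definition multiplier b := [/\ measurable_fun setT b,
  exists K, forall x, `|b x| <= K &
  forall h, L h -> approximable (fun x => b x * h x)].

(** A bounded factor is continuous in L^p, so that the defining property extends
    from [L] to its closure; products of multipliers become multipliers. *)
Lemma multiplier_approximable b f : multiplier b -> approximable f ->
  approximable (fun x => b x * f x).
Proof.
move=> [mb [K bK] bL] [mf af].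
apply: approximable_closed; first exact: measurable_funM.
move=> e e0.
pose K' := `|K| + 1; have K'0 : 0 < K' by rewrite ltr_wpDl.
have [h Lh fh] := af (e / K' `^ p) (divr_gt0 e0 (powR_gt0 _ K'0)).
exists (fun x => b x * h x); first exact: bL.
have mh := L_measurable Lh.
apply: (@le_lt_trans _ _ (power_integral mu p (fun x => K' * (f x - h x)))).
  apply: le_power_integral => //.
  - by apply: measurable_funB; exact: measurable_funM.
  - by apply: measurable_funM => //; exact: measurable_funB.
  move=> x; rewrite -mulrBr !normrM ler_wpM2r// (le_trans (bK x))//.
  by rewrite [`|K'|]gtr0_norm// (le_trans (ler_norm K))// lerDl.
rewrite power_integral_scale//; last exact: measurable_funB.
rewrite gtr0_norm// -lte_pdivlMl ?powR_gt0//.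
by rewrite -EFinM mulrC.
Qed.

Lemma multiplier_cst a : multiplier (cst a).
Proof.
split; [by []|by exists (`|a|)|].
move=> h Lh; apply: approximable_L.
by apply: (LM (L_cst a)).
Qed.

Lemma multiplierM b c : multiplier b -> multiplier c ->
  multiplier (fun x => b x * c x).
Proof.
move=> mb mc; have [mb1 [K bK] bL] := mb; have [mc1 [M cM] cL] := mc.
split; first exact: measurable_funM.
- by exists (K * M) => x; rewrite normrM ler_pM.
- move=> h Lh; under eq_fun do rewrite -mulrA.
  by apply: (multiplier_approximable mb); exact: cL.
Qed.

Lemma multiplierD b c : multiplier b -> multiplier c ->
  multiplier (fun x => b x + c x).
Proof.
move=> [mb [K bK] bL] [mc [M cM] cL]; split; first exact: measurable_funD.
- by exists (K + M) => x; rewrite (le_trans (ler_normD _ _))// lerD.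
- move=> h Lh; under eq_fun do rewrite mulrDl.
  by apply: approximableD; [exact: bL|exact: cL].
Qed.

Lemma multiplierZ a b : multiplier b -> multiplier (fun x => a * b x).
Proof. exact: multiplierM (multiplier_cst a). Qed.

Lemma multiplierB b c : multiplier b -> multiplier c ->
  multiplier (fun x => b x - c x).
Proof.
move=> mb mc; under eq_fun do rewrite -mulN1r.
exact: (multiplierD mb (multiplierZ (-1) mc)).
Qed.

Lemma multiplierX b n : multiplier b -> multiplier (fun x => b x ^+ n).
Proof.
move=> mb; elim: n => [|n IH]; first exact: multiplier_cst.
by under eq_fun do rewrite exprS; exact: (multiplierM mb IH).
Qed.

Lemma multiplier_sum (I : Type) (s : seq I) (b : I -> S -> R) :
  (forall i, multiplier (b i)) -> multiplier (fun x => \sum_(i <- s) b i x).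
Proof.
move=> mb; elim: s => [|i s IH].
  by under eq_fun do rewrite big_nil; exact: multiplier_cst.
by under eq_fun do rewrite big_cons; exact: (multiplierD (mb i) IH).
Qed.

Lemma multiplier_horner (q : {poly R}) b : multiplier b ->
  multiplier (fun x => q.[b x]).
Proof.
move=> mb; under eq_fun do rewrite horner_coef.
apply: multiplier_sum => i.
by apply: multiplierZ; exact: multiplierX.
Qed.

(** Dominated convergence, the dominating function being a multiple of |h|. *)
Lemma multiplier_lim (b_ : nat -> S -> R) b K :
  (forall n, multiplier (b_ n)) -> (forall n x, `|b_ n x| <= K) ->
  (forall x, b_ ^~ x @ \oo --> b x) -> multiplier b.
Proof.
move=> mb bK bb.
have mb1 n : measurable_fun setT (b_ n) by have [] := mb n.
have mbl : measurable_fun setT b.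
  by apply: (measurable_fun_cvg mb1) => x _; exact: bb.
have blK x : `|b x| <= K.
  have /cvg_norm nb := bb x.
  by apply: (cvgr_to_le nb); near=> n; exact: bK.
split; [by []|by exists K|].
move=> h Lh; have mh := L_measurable Lh.
apply: approximable_closed; first exact: measurable_funM.
move=> e e0.
have [C C0 hC] := L_growth1 Lh.
pose g x := K * 2 * C * expR (V x).
have mg : measurable_fun setT g by exact: mexpV.
have [||||n ne] := @power_integral_dominated _ _ _ mu _ p1
    (fun n x => b x * h x - b_ n x * h x) g _ mg _ _ _ e e0.
- by move=> n; apply: measurable_funB; exact: measurable_funM.
- move=> x; rewrite -[X in _ --> X](subrr (b x * h x)).
  apply: cvgB; first exact: cvg_cst.
  by apply: cvgM => //; exact: cvg_cst.
- move=> n x; rewrite -mulrBl normrM /g -mulrA ler_pM//.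
  rewrite (le_trans (ler_normB _ _))// mulr_natr mulr2n lerD//.
- apply: (@power_integral_growth_lty _ `|K * 2 * C|) => // x.
  by rewrite /g normrM [`|expR _|]ger0_norm ?expR_ge0.
exists (fun x => b_ n x * h x) => //.
by have [_ _] := mb n; apply.
Unshelve. all: by end_near. Qed.

Lemma multiplier_abs b : multiplier b -> multiplier (fun x => `|b x|).
Proof.
move=> mb; have [_ [K bK] _] := mb.
(* the polynomials converge on [-1, 1] only, hence the rescaling *)
pose K' := `|K| + 1; have K'0 : 0 < K' by rewrite ltr_wpDl.
have bK' x : `|K'^-1 * b x| <= 1.
  rewrite normrM gtr0_norm ?invr_gt0// ler_pdivrMl// mulr1.
  by rewrite (le_trans (bK x))// (le_trans (ler_norm K))// lerDl.
apply: (@multiplier_lim (fun n x => K' * (abs_poly n).[K'^-1 * b x]) _ K').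
- move=> n.
  exact: (multiplierZ _ (multiplier_horner (abs_poly n) (multiplierZ _ mb))).
- move=> n x; rewrite normrM gtr0_norm// ler_piMr ?(ltW K'0)//.
  have [/andP[p0 px] _] := abs_poly_bounds n (bK' x).
  by rewrite ger0_norm// (le_trans px (bK' x)).
- move=> x; have -> : `|b x| = K' * `|K'^-1 * b x|.
    by rewrite normrM gtr0_norm ?invr_gt0// mulVKf// gt_eqF.
  by apply: cvgM; [exact: cvg_cst|exact: abs_poly_cvg].
Qed.

(** With c the positive part of b scaled to [0, 1], the functions
    1 - (1 - c) ^ n converge to the indicator of the set where b is positive. *)
Lemma multiplier_gt0 b : multiplier b -> multiplier \1_[set x | 0 < b x].
Proof.
move=> mb; have [_ [K bK] _] := mb.
pose K' := `|K| + 1; have K'0 : 0 < K' by rewrite ltr_wpDl.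
have bK' x : `|b x| <= K'.
  by rewrite (le_trans (bK x))// (le_trans (ler_norm K))// lerDl.
pose c x := (K' * 2)^-1 * (b x + `|b x|).
have c01 x : 0 <= c x <= 1.
  have := bK' x; rewrite ler_norml => /andP[b1 b2].
  have a0 : 0 <= b x + `|b x|.
    by rewrite -lerBlDl sub0r -normrN ler_norm.
  rewrite /c mulr_ge0 ?invr_ge0 ?mulr_ge0 ?(ltW K'0)//= ler_pdivrMl ?mulr_gt0//.
  by rewrite mulr1 mulr_natr mulr2n lerD.
apply: (@multiplier_lim (fun n x => 1 - (1 - c x) ^+ n) _ 1).
- move=> n.
  have mc := multiplierZ (K' * 2)^-1 (multiplierD mb (multiplier_abs mb)).
  exact: (multiplierB (multiplier_cst 1)
    (multiplierX n (multiplierB (multiplier_cst 1) mc))).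
- move=> n x; have /andP[c0 c1] := c01 x.
  have h0 : 0 <= (1 - c x) ^+ n by rewrite exprn_ge0// subr_ge0.
  have h1 : (1 - c x) ^+ n <= 1 by rewrite exprn_ile1 ?subr_ge0// gerBl.
  by rewrite ger0_norm ?subr_ge0// gerBl.
- move=> x; have /andP[c0 c1] := c01 x.
  rewrite indicE; have [b0|b0] := ltP 0 (b x); last first.
    have -> : c x = 0 by rewrite /c ler0_norm// subrr mulr0.
    rewrite memNset /=; last by apply/negP; rewrite -leNgt.
    by under eq_fun do rewrite subr0 expr1n subrr; exact: cvg_cst.
  rewrite mem_set//= -[X in _ --> X]subr0; apply: cvgB; first exact: cvg_cst.
  apply: cvg_expr; rewrite ger0_norm ?subr_ge0// gtrBl.
  by rewrite /c mulr_gt0 ?invr_gt0 ?mulr_gt0// ltr_pwDl.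
Qed.


Lemma L_sum (I : Type) (s : seq I) (h : I -> S -> R) :
  (forall i, L (h i)) -> L (fun x => \sum_(i <- s) h i x).
Proof.
move=> Lh; elim: s => [|i s IH].
  by under eq_fun do rewrite big_nil; exact: L_cst.
by under eq_fun do rewrite big_cons; exact: (LD (Lh i) IH).
Qed.

Lemma L_exp h n : L h -> L (fun x => h x ^+ n).
Proof.
move=> Lh; elim: n => [|n IH]; first exact: L_cst.
by under eq_fun do rewrite exprS; exact: (LM Lh IH).
Qed.

Lemma L_scale a h : L h -> L (fun x => a * h x).
Proof. by move=> Lh; exact: (LM (L_cst a) Lh). Qed.

Lemma series_sin_coeff_le (y : R) n : `|series (sin_coeff y) n| <= expR `|y|.
Proof.
apply: (@le_trans _ _ (series (exp_coeff `|y|) n)).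
  rewrite /series /= (le_trans (ler_norm_sum _ _ _))// ler_sum// => i _.
  rewrite /sin_coeff /exp_coeff /= !normrM normfV !normrX normrN1 expr1n mulr1 !normr_nat.
  rewrite ler_wpM2r ?invr_ge0//.
  by rewrite ler_piMl ?exprn_ge0//; case: (odd i).
apply: nondecreasing_cvgn_le; last exact: is_cvg_series_exp_coeff.
by apply: nondecreasing_series => i _ _; exact: exp_coeff_ge0.
Qed.

(** The Taylor polynomials of sin (a g) stay in [L], and the exponential
    integrability of V makes them converge after multiplication by any h in
    [L]; this is where the exponential weight enters. *)
Lemma multiplier_sin g C a : L g -> (forall x, `|g x| <= C * V x) ->
  `|a| * C <= 2^-1 -> multiplier (fun x => sin (a * g x)).
Proof.
move=> Lg gC aC; have mg := L_measurable Lg.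
have mag : measurable_fun setT (fun x => a * g x) by exact: measurable_funM.
have ms : measurable_fun setT (fun x => sin (a * g x)).
  apply: measurableT_comp mag.
  by apply: continuous_measurable_fun => x; exact: continuous_sin.
split; [by []|by exists 1 => x; exact: sin_max|].
move=> h Lh; have mh := L_measurable Lh.
have half0 : 0 < 2^-1 :> R by [].
have [D D0 hD] := L_growth Lh half0.
have agV x : `|a * g x| <= 2^-1 * V x.
  rewrite normrM (le_trans (ler_wpM2l (normr_ge0 a) (gC x)))//.
  by rewrite mulrA ler_wpM2r.
have Ls n : L (fun x => series (sin_coeff (a * g x)) n * h x).
  apply: LM => //; apply: L_sum => i.
  under eq_fun do rewrite sin_coeffE.
  by apply: L_scale; apply: L_exp; exact: L_scale.
apply: approximable_closed; first exact: measurable_funM.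
move=> e e0.
pose G x := 2 * D * expR (V x).
have mG : measurable_fun setT G by exact: mexpV.
have [||||n ne] := @power_integral_dominated _ _ _ mu _ p1
  (fun n x => sin (a * g x) * h x - series (sin_coeff (a * g x)) n * h x) G
  _ mG _ _ _ e e0.
- move=> n; apply: measurable_funB; first exact: measurable_funM.
  exact: (L_measurable (Ls n)).
- move=> x; rewrite -[X in _ --> X](subrr (sin (a * g x) * h x)).
  apply: cvgB; first exact: cvg_cst.
  apply: cvgM; last exact: cvg_cst.
  by rewrite sin.unlock; exact: is_cvg_series_sin_coeff.
- move=> n x; rewrite -mulrBl normrM.
  have E : expR (V x) = expR (2^-1 * V x) * expR (2^-1 * V x).
    by rewrite -expRD; congr expR; field.
  have -> : G x = 2 * expR (2^-1 * V x) * (D * expR (2^-1 * V x)).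
    by rewrite /G E; ring.
  rewrite ler_pM// (le_trans (ler_normB _ _))// mulr_natl mulr2n lerD//.
    by rewrite (le_trans (sin_max _))// -expR0 ler_expR mulr_ge0.
  by rewrite (le_trans (series_sin_coeff_le _ _))// ler_expR.
- apply: (@power_integral_growth_lty _ (2 * D)) => // x.
  by rewrite /G ger0_norm// mulr_ge0 ?expR_ge0// mulr_ge0.
exists (fun x => series (sin_coeff (a * g x)) n * h x) => //.
exact: approximable_L.
Qed.

Definition multiplier_sets : set (set S) := [set A | multiplier \1_A].

(** A countable union is reached through the products of the complementary
    indicators, which are eventually constant at each point. *)
Lemma multiplier_sets_sigma_algebra : sigma_algebra setT multiplier_sets.
Proof.
split.
- by rewrite /multiplier_sets /= indic0; exact: multiplier_cst.
- move=> A mA; rewrite /multiplier_sets /= setTD.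
  have -> : \1_(~` A) = (fun x => cst 1 x - \1_A x) :> (S -> R).
    by apply/funext => x; rewrite !indicE in_setC; case: (x \in A); rewrite ?subrr ?subr0.
  exact: (multiplierB (multiplier_cst 1) mA).
- move=> A mA; rewrite /multiplier_sets /=.
  pose c n x : R := \prod_(i < n) (1 - \1_(A i) x).
  have mc n : multiplier (c n).
    elim: n => [|n IH].
      by rewrite /c; under eq_fun do rewrite big_ord0; exact: multiplier_cst.
    rewrite /c; under eq_fun do rewrite big_ord_recr /=.
    exact: (multiplierM IH (multiplierB (multiplier_cst 1) (mA n))).
  apply: (@multiplier_lim (fun n x => 1 - c n x) _ 1).
  + by move=> n; exact: (multiplierB (multiplier_cst 1) (mc n)).
  + move=> n x; have c01 : 0 <= c n x <= 1.
      apply/andP; split.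
        by apply: prodr_ge0 => i _; rewrite indicE; case: (_ \in _); rewrite ?subrr ?subr0.
      by apply: prodr_ile1 => i _; rewrite indicE; case: (_ \in _); rewrite ?subrr ?subr0 ?lexx ?ler01.
    by move/andP: c01 => [c0 c1]; rewrite ger0_norm ?subr_ge0// gerBl.
  + move=> x; rewrite indicE; have [xA|xA] := pselect ((\bigcup_k A k) x).
      rewrite mem_set//=; have [k _ Akx] := xA.
      apply: (cvg_trans _ (@cvg_cst _ (1 : R) _ \oo _)); apply: near_eq_cvg; near=> n.
      have kn : (k < n)%N by near: n; exact: nbhs_infty_gt.
      by rewrite /c (bigD1 (Ordinal kn))//= indicE mem_set// subrr mul0r subr0.
    rewrite memNset//=; under eq_fun => n.
      rewrite /c big1; last first.
        move=> i _; rewrite indicE memNset ?subr0// => Ax; apply: xA; by exists i.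
      rewrite subrr; over.
    exact: cvg_cst.
Unshelve. all: by end_near. Qed.

Local Notation multiplier_type := (g_sigma_algebraType multiplier_sets).

Lemma measurable_multiplier (b : S -> R) : multiplier b ->
  measurable_fun setT (b : multiplier_type -> R).
Proof.
move=> mb mD; apply: (measurability _ (RGenOInfty.measurableE R)) => //.
move=> /= _ [_ [a ->] <-]; rewrite setTI; apply: sub_sigma_algebra.
rewrite /multiplier_sets /=.
have -> : b @^-1` `]a, +oo[%classic = [set x | 0 < b x - cst a x].
  by apply/seteqP; split=> x /=; rewrite in_itv /= andbT subr_gt0.
exact: (multiplier_gt0 (multiplierB mb (multiplier_cst a))).
Qed.

Variable G : set (S -> R).
Hypothesis GL : G `<=` L.
Hypothesis G_growth : forall g, G g ->
  exists C : R, forall x, `|g x| <= C * V x.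
Hypothesis G_generates : forall Sigma : set (set S), sigma_algebra setT Sigma ->
  (forall g, G g -> measurable_fun setT (g : g_sigma_algebraType Sigma -> R)) ->
  forall A : set S, measurable A -> Sigma A.

(** [sin (g / n)] is a multiplier for large n, and g is recovered as the limit
    of [n sin (g / n)]; this transfers the measurability from the bounded
    multipliers to the unbounded g. *)
Lemma multiplier_indic (A : set S) : measurable A -> multiplier \1_A.
Proof.
move=> mA; apply: (G_generates multiplier_sets_sigma_algebra _ mA) => g Gg.
have [C gC] := G_growth Gg.
have [N CN] : exists N : nat, `|C| * 2 <= N%:R.
  exists (Num.trunc (`|C| * 2)).+1; apply: ltW.
  exact: truncnS_gt.
have ms n : multiplier (fun x => sin ((n + N).+1%:R^-1 * g x)).
  apply: (@multiplier_sin g `|C|); first exact: GL.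
    by move=> x; rewrite (le_trans (gC x))// ler_wpM2r// ler_norm.
  rewrite gtr0_norm ?invr_gt0// ler_pdivrMl// ler_pdivlMr//.
  by rewrite (le_trans CN)// ler_nat -addSn leq_addl.
have ms' n : measurable_fun setT
    ((fun x => (n + N).+1%:R * sin ((n + N).+1%:R^-1 * g x)) : multiplier_type -> R).
  exact: (measurable_multiplier (multiplierZ _ (ms n))).
apply: (measurable_fun_cvg ms') => x _.
by have := @sin_scaled_cvg R (g x); rewrite -(cvg_shiftn N).
Qed.

(** Simple functions are combinations of multiplier indicators, and they
    approximate f from below, hence boundedly. *)
Lemma multiplier_bounded f K : measurable_fun setT f ->
  (forall x, 0 <= f x <= K) -> multiplier f.
Proof.
move=> mf fK.
have mf' : measurable_fun setT (EFin \o f) by exact/measurable_EFinP.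
have f0 x : setT x -> (0 <= (f x)%:E)%E.
  by move=> _; rewrite lee_fin; have /andP[] := fK x.
have [s [s_incr s_cvg]] := approximation measurableT mf' f0.
have sf x : s n x @[n --> \oo] --> f x by exact: (fine_cvg (s_cvg x I)).
apply: (@multiplier_lim (fun n x => s n x) _ K) => //.
- move=> n; under eq_fun do rewrite fimfunE fsbig_finite//=.
  apply: multiplier_sum => y; apply: multiplierZ.
  by apply: multiplier_indic; exact: measurable_sfunP.
- move=> n x; have /andP[_ fxK] := fK x.
  rewrite ger0_norm//; apply: le_trans fxK.
  have s_nd : nondecreasing_seq (s ^~ x) by move=> i j /s_incr/lefP.
  have <- : limn (s ^~ x) = f x by exact: cvg_lim (sf x).
  by apply: nondecreasing_cvgn_le => //; apply/cvg_ex; exists (f x); exact: sf.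
Qed.

(** Density in L^p: truncations of f are multipliers, hence limits of
    elements of L because the constant 1 belongs to L. *)
Theorem generated_algebra_dense f : measurable_fun setT f ->
  (power_integral mu p f < +oo)%E -> approximable f.
Proof.
move=> mf fp.
pose A n := [set x | `|f x| <= n%:R].
have mA n : measurable (A n).
  rewrite /A -[X in measurable X]setTI; apply: measurable_fun_le => //.
  exact: measurableT_comp.
have mfA n : measurable_fun setT (fun x => f x * \1_(A n) x).
  by apply: measurable_funM => //; exact: measurable_indic.
have aA n : approximable (fun x => f x * \1_(A n) x).
  have : multiplier (fun x => f x * \1_(A n) x).
    have -> : (fun x => f x * \1_(A n) x) =
        (fun x => (f x * \1_(A n) x + n%:R) - cst n%:R x).
      by apply/funext => x /=; rewrite addrK.
    apply: multiplierB (multiplier_cst _).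
    apply: (@multiplier_bounded _ (n%:R + n%:R)); first exact: measurable_funD.
    move=> x; rewrite indicE; have [xA|xA] := pselect (A n x).
      rewrite mem_set//= mulr1; move: xA; rewrite /A /= ler_norml => /andP[f1 f2].
      by rewrite -lerBlDr sub0r f1 lerD2r.
    by rewrite memNset//= mulr0 add0r ler0n lerDl ler0n.
  move=> /multiplier_approximable/(_ (approximable_L (L_cst 1))).
  by under eq_fun do rewrite mulr1.
apply: approximable_closed => // e e0.
have [|||||n ne] := @power_integral_dominated _ _ _ mu _ p1
  (fun n x => f x - f x * \1_(A n) x) (fun x => `|f x|) _ _ _ _ _ e e0.
- by move=> n; exact: measurable_funB.
- exact: measurableT_comp.
- move=> x; have [N fN] : exists N : nat, `|f x| <= N%:R.
    by exists (Num.trunc `|f x|).+1; apply: ltW; exact: truncnS_gt.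
  apply: (cvg_trans _ (@cvg_cst _ (0 : R) _ \oo _)); apply: near_eq_cvg; near=> n.
  rewrite indicE mem_set ?mulr1 ?subrr// /A /= (le_trans fN)// ler_nat.
  by near: n; exact: nbhs_infty_ge.
- move=> n x; rewrite indicE; case: (_ \in _); first by rewrite mulr1 subrr normr0.
  by rewrite mulr0 subr0.
- by rewrite /power_integral; under eq_integral do rewrite normr_id.
by exists (fun x => f x * \1_(A n) x).
Unshelve. all: by end_near. Qed.

End Multipliers.

(** * Primitives up to quadratic remainders *)

Section QuadraticRemainders.
Context {R : realType}.
Implicit Types (t u v C : R) (f g F A : R -> R).

(** The identity dF = f dg, encoded without any integral by a bound that sums to
    zero over finer and finer partitions. *)
Definition stieltjes_primitive t F f g := exists2 C : R, 0 <= C &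
  forall u v, 0 <= u -> u <= v -> v <= t ->
    `|F v - F u - f u * (g v - g u)| <= C * (v - u) ^+ 2.

Definition lipschitz_on t f := exists2 C : R, 0 <= C &
  forall u v, 0 <= u -> u <= v -> v <= t -> `|f v - f u| <= C * (v - u).

(** A quadratic error disappears when the interval is cut in n equal pieces
    and n tends to infinity. *)
Lemma quadratic_control t C F A : 0 <= t ->
  (forall u v, 0 <= u -> u <= v -> v <= t ->
    `|F v - F u| <= A v - A u + C * (v - u) ^+ 2) ->
  `|F t - F 0| <= A t - A 0.
Proof.
move=> t0 FA; apply/ler_addgt0Pr => e e0.
have [n nC] : exists n : nat, `|C| * t ^+ 2 / e <= n.+1%:R.
  by exists (Num.trunc (`|C| * t ^+ 2 / e)); apply: ltW; exact: truncnS_gt.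
pose x k : R := k%:R / n.+1%:R * t.
have n0 : 0 < n.+1%:R :> R by [].
have x0 : x 0%N = 0 by rewrite /x !mul0r.
have xn : x n.+1 = t by rewrite /x divff ?mul1r// gt_eqF.
have xS k : x k.+1 - x k = t / n.+1%:R.
  by rewrite /x -mulrBl -mulrBl -natr1 addrAC subrr add0r mulrC mul1r.
have xge k : 0 <= x k by rewrite /x !mulr_ge0// invr_ge0 ltW.
have xle k : (k <= n.+1)%N -> x k <= t.
  by move=> kn; rewrite /x ler_piMl// ler_pdivrMr// mul1r ler_nat.
have xinc k : x k <= x k.+1 by rewrite -subr_ge0 xS divr_ge0// ltW.
have -> : F t - F 0 = \sum_(0 <= k < n.+1) (F (x k.+1) - F (x k)).
  by rewrite (telescope_sumr (F \o x))//= x0 xn.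
apply: (@le_trans _ _ (\sum_(0 <= k < n.+1)
    ((A (x k.+1) - A (x k)) + `|C| * (t / n.+1%:R) ^+ 2))).
  rewrite (le_trans (ler_norm_sum _ _ _))// big_nat [leRHS]big_nat ler_sum// => k /= kn.
  rewrite (le_trans (FA _ _ (xge k) (xinc k) (xle _ kn)))// lerD2l xS.
  by rewrite ler_wpM2r ?sqr_ge0// ler_norm.
rewrite big_split /= (telescope_sumr (A \o x))//= x0 xn lerD2l.
rewrite sumr_const_nat subn0 -[leLHS]mulr_natr.
have -> : `|C| * (t / n.+1%:R) ^+ 2 * n.+1%:R = `|C| * t ^+ 2 / n.+1%:R.
  by field; rewrite gt_eqF.
by rewrite ler_pdivrMr// [e * _]mulrC -ler_pdivrMr.
Qed.

(** The difference of two primitives has quadratic increments, so that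
    [quadratic_control] with A = 0 makes it constant. *)
Lemma stieltjes_primitive_unique t F F' f g :
  stieltjes_primitive t F f g -> stieltjes_primitive t F' f g -> F 0 = F' 0 ->
  forall u, 0 <= u -> u <= t -> F u = F' u.
Proof.
move=> [C C0 hF] [C' C'0 hF'] F0 u u0 ut.
have : `|(F u - F' u) - (F 0 - F' 0)| <= cst 0 u - cst 0 (0 : R).
  apply: (@quadratic_control u (C + C') (fun x => F x - F' x)) => // a b a0 ab bu.
  rewrite subrr add0r mulrDl.
  have -> : F b - F' b - (F a - F' a) =
    (F b - F a - f a * (g b - g a)) - (F' b - F' a - f a * (g b - g a)) by ring.
  by rewrite (le_trans (ler_normB _ _))// lerD// ?hF ?hF'// (le_trans bu).
by rewrite F0 !subrr subr0 normr_le0 subr_eq0 => /eqP.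
Qed.

Lemma lipschitz_on_bounded t f : lipschitz_on t f ->
  exists2 M : R, 0 <= M & forall u, 0 <= u -> u <= t -> `|f u| <= M.
Proof.
move=> [C C0 hC]; exists (`|f 0| + C * `|t|); first by rewrite addr_ge0// mulr_ge0.
move=> u u0 ut; rewrite -[f u](subrK (f 0)) addrC (le_trans (ler_normD _ _))// lerD2l.
by rewrite (le_trans (hC _ _ (lexx 0) u0 ut))// ler_wpM2l// subr0 (le_trans ut)// ler_norm.
Qed.

Lemma stieltjes_primitive_lipschitz t F f g : lipschitz_on t f ->
  lipschitz_on t g -> stieltjes_primitive t F f g -> lipschitz_on t F.
Proof.
move=> /lipschitz_on_bounded[M M0 fM] [G G0 hG] [C C0 hF].
exists (M * G + C * `|t|); first by rewrite addr_ge0// mulr_ge0.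
move=> u v u0 uv vt.
rewrite -[F v - F u](subrK (f u * (g v - g u))) addrC.
rewrite (le_trans (ler_normD _ _))// [leRHS]mulrDl lerD//.
  by rewrite normrM -mulrA ler_pM// ?hG// fM// (le_trans uv).
rewrite (le_trans (hF _ _ u0 uv vt))// expr2 mulrA ler_wpM2r ?subr_ge0//.
by rewrite ler_wpM2l// (le_trans _ (ler_norm t))// lerBlDr (le_trans vt)// lerDl.
Qed.

(** Leibniz' rule; the product of two increments is itself quadratic. *)
Lemma stieltjes_primitiveM t F f g F' f' g' :
  lipschitz_on t F -> lipschitz_on t F' ->
  stieltjes_primitive t F f g -> stieltjes_primitive t F' f' g' ->
  exists2 C : R, 0 <= C & forall u v, 0 <= u -> u <= v -> v <= t ->
    `|F v * F' v - F u * F' u - (f u * F' u * (g v - g u) +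
        F u * f' u * (g' v - g' u))| <= C * (v - u) ^+ 2.
Proof.
move=> lF lF'; have [M M0 FM] := lipschitz_on_bounded lF.
have [M' M'0 FM'] := lipschitz_on_bounded lF'.
have [L L0 hL] := lF; have [L' L'0 hL'] := lF'.
move=> [C C0 hC] [C' C'0 hC'].
exists (L * L' + (M' * C + M * C')).
  by rewrite !addr_ge0 ?mulr_ge0.
move=> u v u0 uv vt; have ut := le_trans uv vt.
have -> : F v * F' v - F u * F' u - (f u * F' u * (g v - g u) +
        F u * f' u * (g' v - g' u)) = (F v - F u) * (F' v - F' u) +
    (F' u * (F v - F u - f u * (g v - g u)) +
     F u * (F' v - F' u - f' u * (g' v - g' u))) by ring.
rewrite (le_trans (ler_normD _ _))// [leRHS]mulrDl lerD//.
  rewrite normrM expr2.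
  have -> : L * L' * ((v - u) * (v - u)) = (L * (v - u)) * (L' * (v - u)) by ring.
  by rewrite ler_pM// ?hL ?hL'.
rewrite (le_trans (ler_normD _ _))// [leRHS]mulrDl lerD// normrM -mulrA.
  by rewrite ler_pM// ?FM' ?hC.
by rewrite ler_pM// ?FM ?hC'.
Qed.

End QuadraticRemainders.

(** * Evaluation of Riemann-Stieltjes integrals *)

Section RiemannStieltjes.
Context {R : realType}.
Implicit Types (t u v C a b : R) (f g F A : R -> R) (s : seq R).

Lemma itv_partition_nth a b s k : itv_partition a b s -> (k < size s)%N ->
  [/\ a <= (a :: s)`_k, (a :: s)`_k < s`_k & s`_k <= b].
Proof.
move=> abs ks; have [ps _] := abs; split.
- have -> : (a :: s)`_k = nth b (a :: s) k by apply: set_nth_default; rewrite ltnW.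
  by apply: itv_partition_nth_ge abs; rewrite ltnW.
- by move/(pathP 0) : ps; apply.
- have -> : s`_k = nth b (a :: s) k.+1 by apply: set_nth_default.
  exact: itv_partition_nth_le abs.
Qed.

Lemma itv_partition_telescope a b s f : itv_partition a b s ->
  f b - f a = \sum_(k < size s) (f s`_k - f (a :: s)`_k).
Proof.
move=> abs.
have -> : \sum_(k < size s) (f s`_k - f (a :: s)`_k) =
    \sum_(0 <= k < size s) (f (a :: s)`_k.+1 - f (a :: s)`_k).
  by rewrite big_mkord.
by rewrite (telescope_sumr (fun k => f (a :: s)`_k))// (itv_partition_nth_size 0 abs).
Qed.

Lemma fine_itv_partition a b e : a <= b -> 0 < e -> exists2 s,
  itv_partition a b s & forall k, (k < size s)%N -> s`_k - (a :: s)`_k < e.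
Proof.
rewrite le_eqVlt => /predU1P[<-|ab] e0.
  by exists [::] => //; split => //=.
pose n := Num.trunc ((b - a) / e).
have ne : b - a < e * n.+1%:R by rewrite mulrC -ltr_pdivrMr// truncnS_gt.
have n0 : 0 < n.+1%:R :> R by [].
pose x k : R := a + (b - a) * (k%:R / n.+1%:R).
pose s := [seq x k.+1 | k <- iota 0 n.+1].
have ss : size s = n.+1 by rewrite size_map size_iota.
have sk k : (k < n.+1)%N -> s`_k = x k.+1.
  by move=> kn; rewrite (nth_map 0%N) ?size_iota// nth_iota.
have ask k : (k < n.+1)%N -> (a :: s)`_k = x k.
  case: k => [_|k kn] /=; first by rewrite /x mul0r mulr0 addr0.
  by rewrite sk// ltnW.
have xS k : x k.+1 - x k = (b - a) / n.+1%:R.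
  rewrite /x opprD addrACA subrr add0r -mulrBr -mulrBl -natr1 addrAC subrr.
  by rewrite add0r mul1r.
exists s; last first.
  by move=> k; rewrite ss => kn; rewrite sk// ask// xS ltr_pdivrMr.
split.
  apply/(pathP 0) => k; rewrite ss => kn.
  by rewrite sk// ask// -subr_gt0 xS divr_gt0// subr_gt0.
rewrite (last_nth 0) ss; change ((a :: s)`_n.+1) with s`_n.
by rewrite sk// /x divff ?lt0r_neq0// mulr1 addrC subrK.
Qed.

(** Two values of the integral are compared on a single fine partition. *)
Lemma RS_integralE f g a b v : a <= b -> is_RS_integral f g a b v ->
  RS_integral f g a b = v.
Proof.
move=> ab fgv; apply/get_unique => // w fgw.
apply/eqP; rewrite -subr_eq0 -normr_le0; apply/ler_addgt0Pl => e e0.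
rewrite addr0.
have e2 : 0 < e / 2 by rewrite divr_gt0.
have [d1 d10 h1] := fgv _ e2; have [d2 d20 h2] := fgw _ e2.
have d0 : 0 < Num.min d1 d2 by rewrite lt_min d10.
have [s abs sd] := fine_itv_partition ab d0.
have tag (d : R) k : (k < size s)%N -> s`_k - (a :: s)`_k < Num.min d1 d2 ->
    Num.min d1 d2 <= d ->
    s`_k - (a :: s)`_k < d /\ (a :: s)`_k <= (a :: s)`_k <= s`_k.
  move=> ks skd dd; split; first exact: lt_le_trans dd.
  by rewrite lexx ltW//; have [] := itv_partition_nth abs ks.
have dd1 : Num.min d1 d2 <= d1 by rewrite ge_min lexx.
have dd2 : Num.min d1 d2 <= d2 by rewrite ge_min lexx orbT.
have {}h1 := h1 s (fun k => (a :: s)`_k) abs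
  (fun k ks => tag d1 k ks (sd k ks) dd1).
have {}h2 := h2 s (fun k => (a :: s)`_k) abs
  (fun k ks => tag d2 k ks (sd k ks) dd2).
set r := RS_sum _ _ _ _ _ in h1 h2.
have -> : w - v = (r - v) - (r - w) by ring.
by rewrite (splitr e) (le_trans (ler_normB _ _))// lerD// ltW.
Qed.

(** A Riemann-Stieltjes sum differs from the increment of F by a sum of squares
    of steps, which is at most the mesh times the length of the interval. *)
Lemma RS_integral_primitive t F f g : 0 <= t -> lipschitz_on t f ->
  lipschitz_on t g -> stieltjes_primitive t F f g ->
  RS_integral f g 0 t = F t - F 0.
Proof.
move=> t0 [Lf Lf0 hf] [Lg Lg0 hg] [C C0 hF]; apply: RS_integralE => // e e0.
pose K := Lf * Lg + C.
have K0 : 0 <= K by rewrite addr_ge0// mulr_ge0.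
have Kt : 0 < K * t + 1 by rewrite ltr_wpDl// mulr_ge0.
exists (e / (K * t + 1)); first by rewrite divr_gt0.
move=> s xi ts sxi; rewrite (itv_partition_telescope _ ts) /RS_sum -sumrB.
set d := e / _ in sxi.
have d0 : 0 < d by rewrite divr_gt0.
apply: (@le_lt_trans _ _ (\sum_(k < size s) K * d * (s`_k - (0 :: s)`_k))).
  rewrite (le_trans (ler_norm_sum _ _ _))// ler_sum// => k _.
  have [p0 ps st] := itv_partition_nth ts (ltn_ord k).
  have [dk /andP[px xs]] := sxi k (ltn_ord k).
  set p := (0 :: s)`_k in p0 ps dk px *; set q := s`_k in ps st dk xs *.
  set x := xi k in px xs *.
  have -> : f x * (g q - g p) - (F q - F p) =
    (f x - f p) * (g q - g p) - (F q - F p - f p * (g q - g p)) by ring.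
  have pq := ltW ps.
  apply: (@le_trans _ _ (K * (q - p) ^+ 2)).
    rewrite (le_trans (ler_normB _ _))// [leRHS]mulrDl lerD ?hF//.
    rewrite normrM.
    have -> : Lf * Lg * (q - p) ^+ 2 = Lf * (q - p) * (Lg * (q - p)) by ring.
    rewrite ler_pM// ?hg//.
    by rewrite (le_trans (hf _ _ p0 px (le_trans xs st)))// ler_wpM2l// lerD2r.
  rewrite -mulrA ler_wpM2l// expr2 ler_wpM2r ?subr_ge0//.
  exact: ltW.
rewrite -mulr_sumr -(itv_partition_telescope id ts) subr0.
have -> : K * d * t = K * t * d by ring.
by rewrite /d mulrCA -[ltRHS]mulr1 ltr_pM2l// ltr_pdivrMr// mul1r ltrDl.
Qed.

(** The Lebesgue integral of the extension of f by constants is differentiable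
    everywhere, and the mean value theorem gives the quadratic bound. *)
Lemma lipschitz_antiderivative t f : lipschitz_on t f -> exists H : R -> R,
  exists2 C : R, 0 <= C & forall u v, 0 <= u -> u <= v -> v <= t ->
    `|H v - H u - f u * (v - u)| <= C * (v - u) ^+ 2.
Proof.
move=> [C C0 hf]; have [t0|t0] := leP t 0.
  exists (cst 0), 0 => // u v u0 uv vt.
  have -> : v = u by apply/eqP; rewrite eq_le uv (le_trans vt)// (le_trans t0).
  by rewrite !subrr mulr0 subrr normr0 expr0n mulr0.
pose h x := f (Num.max 0 (Num.min x t)).
have hf0 (x : R) : 0 <= x -> x <= t -> h x = f x.
  by move=> x0 xt; rewrite /h (min_l xt) (max_r x0).
have hC x y : x <= y -> `|h y - h x| <= C * (y - x).
  move=> xy; rewrite /h.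
  have [x1 x2 x3] : [/\ Num.min x t <= Num.min y t, Num.min y t <= t &
      Num.min y t - Num.min x t <= y - x].
    by case: (leP x t) => ?; case: (leP y t) => ?; split; lra.
  move: (Num.min x t) (Num.min y t) x1 x2 x3 => m n x1 x2 x3.
  have [m1 m2 m3 m4] : [/\ 0 <= Num.max 0 m, Num.max 0 m <= Num.max 0 n,
      Num.max 0 n <= t & Num.max 0 n - Num.max 0 m <= y - x].
    by case: (leP 0 m) => ?; case: (leP 0 n) => ?; split; lra.
  by rewrite (le_trans (hf _ _ m1 m2 m3))// ler_wpM2l.
have C1 : 0 < C + 1 by rewrite ltr_wpDl.
have ch : continuous h.
  move=> x; apply/cvgrPdist_le => /= e e0; near=> y.
  have hCn : `|h x - h y| <= C * `|x - y|.
    have [xy|/ltW yx] := leP x y.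
      by rewrite distrC [`|x - y|]distrC [`|y - x|]ger0_norm ?subr_ge0 ?hC.
    by rewrite [`|x - y|]ger0_norm ?subr_ge0 ?hC.
  rewrite (le_trans hCn)// (@le_trans _ _ ((C + 1) * `|x - y|))//.
    by rewrite ler_wpM2r// lerDl.
  rewrite -ler_pdivlMl//; near: y.
  have e'0 : 0 < (C + 1)^-1 * e by rewrite mulr_gt0// invr_gt0.
  exact: (@cvgr_dist_le _ _ _ _ _ id x (@cvg_id _ (nbhs x)) _ e'0).
(* starting at -1 makes 0 an interior point *)
pose H (x : R) : R := (\int[lebesgue_measure]_(y in `[-1, x]) h y)%R.
have H' (x : R) : 0 <= x -> is_derive x 1 H (h x).
  move=> x0.
  have xx : x < x + 1 by rewrite ltrDl.
  have [|||] := @continuous_FTC1 R h (BLeft (-1)) x (x + 1) xx.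
  - apply: continuous_compact_integrable; first exact: segment_compact.
    exact: continuous_subspaceT.
  - by rewrite /= lte_fin (lt_le_trans _ x0)// ltrN10.
  - exact: ch.
  - by move=> dH HE; apply: (DeriveDef dH); rewrite -derive1E; exact: HE.
exists H, C => // u v u0 uv vt.
have [c cuv ->] : exists2 c, c \in `[u, v] & H v - H u = h c * (v - u).
  apply: MVT_segment => //.
  - move=> x; rewrite in_itv /= => /andP[ux _]; apply: H'.
    exact: (le_trans u0 (ltW ux)).
  - apply: derivable_within_continuous => x; rewrite in_itv /= => /andP[ux _].
    by have [] := H' x (le_trans u0 ux).
move: cuv; rewrite in_itv /= => /andP[uc cv].
rewrite -mulrBl normrM [`|v - u|]ger0_norm ?subr_ge0// expr2 mulrA.
rewrite ler_wpM2r ?subr_ge0// hf0 ?(le_trans u0 uc) ?(le_trans cv)//.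
by rewrite (le_trans (hf _ _ u0 uc (le_trans cv vt)))// ler_wpM2l// lerD2r.
Unshelve. all: by end_near. Qed.

End RiemannStieltjes.

(** * Piecewise linear integrators *)

Section StieltjesSums.
Context {R : realType}.
Variables (n : nat) (knot : nat -> R).
Implicit Types (t u v C : R) (f g H : R -> R) (b : nat -> R).

(** The integral over [0, u] of H' against the path that has slope [b j]
    between [knot j] and [knot j.+1]. For H the identity, this is the path
    itself (started at 0). *)
Definition slope_sum b H u : R :=
  \sum_(j < n) b j * (H (Num.min (knot j.+1) u) - H (Num.min (knot j) u)).

Local Notation clamp x u v := (Num.max u (Num.min x v)).

Lemma min_increment x H u v : u <= v ->
  H (Num.min x v) - H (Num.min x u) = H (clamp x u v) - H u.
Proof.
move=> uv; case: (leP x u) => xu.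
  by rewrite (min_l (le_trans xu uv)) (max_l xu) !subrr.
by rewrite max_r// le_min (ltW xu).
Qed.

(** On [u, v] only the parts of the intervals that lie in [u, v] contribute. *)
Lemma slope_sum_increment b H u v : u <= v ->
  slope_sum b H v - slope_sum b H u =
  \sum_(j < n) b j * (H (clamp (knot j.+1) u v) - H (clamp (knot j) u v)).
Proof.
move=> uv; rewrite -sumrB; apply: eq_bigr => j _; rewrite -mulrBr; congr (_ * _).
have h1 := min_increment (knot j.+1) H uv; have h2 := min_increment (knot j) H uv.
have -> : H (clamp (knot j.+1) u v) - H (clamp (knot j) u v) =
  (H (clamp (knot j.+1) u v) - H u) - (H (clamp (knot j) u v) - H u) by ring.
by rewrite -h1 -h2; ring.
Qed.

Hypothesis knot_incr : forall j, (j < n)%N -> knot j <= knot j.+1.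

Lemma clamp_bounds x y u v : u <= v -> x <= y ->
  [/\ u <= clamp x u v, clamp x u v <= clamp y u v & clamp y u v <= v].
Proof.
move=> uv xy; split.
- by rewrite le_max lexx.
- have : Num.min x v <= Num.min y v.
    by case: (leP x v) => ?; case: (leP y v) => ?; lra.
  move: (Num.min x v) (Num.min y v) => a b.
  by case: (leP u a) => ?; case: (leP u b) => ?; lra.
- by rewrite ge_max uv ge_min lexx orbT.
Qed.

Definition slope_variation b := slope_sum (fun j => `|b j|) id.

Lemma slope_sum_control b u v : u <= v ->
  `|slope_sum b id v - slope_sum b id u| <=
  slope_variation b v - slope_variation b u.
Proof.
move=> uv; rewrite !slope_sum_increment// (le_trans (ler_norm_sum _ _ _))//.
apply: ler_sum => j _; have [_ pq _] := clamp_bounds uv (knot_incr (ltn_ord j)).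
by rewrite normrM [`|_ - _|]ger0_norm ?subr_ge0.
Qed.

Lemma slope_sum_lipschitz t b : lipschitz_on t (slope_sum b id).
Proof.
exists (\sum_(j < n) `|b j|); first exact: sumr_ge0.
move=> u v u0 uv vt; rewrite slope_sum_increment//.
rewrite (le_trans (ler_norm_sum _ _ _))// mulr_suml; apply: ler_sum => j _.
have [up pq qv] := clamp_bounds uv (knot_incr (ltn_ord j)).
rewrite normrM ler_wpM2l// ger0_norm ?subr_ge0//.
by rewrite lerB.
Qed.

(** On one interval, the increment of H differs from f du by a quadratic term,
    and the value of f at the left end of the interval differs from f u by a
    multiple of v - u. *)
Lemma slope_sum_primitive t b H f : lipschitz_on t f ->
  (exists2 C : R, 0 <= C & forall u v, 0 <= u -> u <= v -> v <= t ->
    `|H v - H u - f u * (v - u)| <= C * (v - u) ^+ 2) ->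
  stieltjes_primitive t (slope_sum b H) f (slope_sum b id).
Proof.
move=> [L L0 hL] [C C0 hC].
exists ((\sum_(j < n) `|b j|) * (C + L)).
  by rewrite mulr_ge0 ?addr_ge0 ?sumr_ge0.
move=> u v u0 uv vt; rewrite !slope_sum_increment// mulr_sumr -sumrB -mulrA mulr_suml.
rewrite (le_trans (ler_norm_sum _ _ _))//; apply: ler_sum => j _.
have [] := clamp_bounds uv (knot_incr (ltn_ord j)).
set p := clamp (knot j) u v; set q := clamp (knot j.+1) u v => up pq qv.
have -> : b j * (H q - H p) - f u * (b j * (id q - id p)) =
  b j * ((H q - H p - f p * (q - p)) + (f p - f u) * (q - p)) by rewrite /=; ring.
rewrite normrM ler_wpM2l// (le_trans (ler_normD _ _))// [leRHS]mulrDl.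
have p0 := le_trans u0 up; have qt := le_trans qv vt.
have qp_vu : q - p <= v - u by rewrite lerB.
have qp0 : 0 <= q - p by rewrite subr_ge0.
rewrite lerD//.
  by rewrite (le_trans (hC _ _ p0 pq qt))// ler_wpM2l// ler_sqr// nnegrE (le_trans qp0).
rewrite normrM expr2 mulrA ler_pM//; last by rewrite ger0_norm.
by rewrite (le_trans (hL _ _ u0 up (le_trans pq qt)))// ler_wpM2l// lerB// (le_trans pq).
Qed.

Hypothesis knot_ge0 : forall j, 0 <= knot j.

Lemma slope_sum0 b H : slope_sum b H 0 = 0.
Proof.
by rewrite /slope_sum big1// => j _; rewrite !min_r// subrr mulr0.
Qed.

Lemma slope_variation_ge0 b u : 0 <= u -> 0 <= slope_variation b u.
Proof.
move=> u0; have := slope_sum_control b u0.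
rewrite /slope_variation [slope_sum _ _ 0 in X in _ <= X]slope_sum0 subr0.
exact: le_trans.
Qed.

Lemma slope_variation_nd b u v : u <= v ->
  slope_variation b u <= slope_variation b v.
Proof.
by move=> uv; rewrite -subr_ge0; apply: le_trans (slope_sum_control b uv).
Qed.

(** The usual estimate of a Stieltjes integral by the supremum of the integrand
    and the variation of the integrator, by [quadratic_control]. *)
Lemma primitive_le_variation t b F f M :
  stieltjes_primitive t F f (slope_sum b id) ->
  (forall u, 0 <= u -> u <= t -> `|f u| <= M) ->
  forall u, 0 <= u -> u <= t -> `|F u - F 0| <= M * slope_variation b u.
Proof.
move=> [C C0 hC] fM u u0 ut.
have : `|F u - F 0| <= M * slope_variation b u - M * slope_variation b 0.
  apply: (@quadratic_control _ u C F (fun x => M * slope_variation b x)) => //.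
  move=> x y x0 xy yu; have yt := le_trans yu ut.
  have -> : F y - F x = f x * (slope_sum b id y - slope_sum b id x) +
    (F y - F x - f x * (slope_sum b id y - slope_sum b id x)) by ring.
  rewrite (le_trans (ler_normD _ _))// lerD ?hC// normrM -mulrBr ler_pM//.
    by rewrite fM// (le_trans xy).
  exact: slope_sum_control.
by rewrite /slope_variation slope_sum0 mulr0 subr0.
Qed.

End StieltjesSums.

(** * Calculus of primitives *)

Section PrimitiveCalculus.
Context {R : realType}.
Implicit Types (t u v C : R) (f g F H : R -> R).

Lemma stieltjes_primitive_sub t t' F f g : t' <= t ->
  stieltjes_primitive t F f g -> stieltjes_primitive t' F f g.
Proof.
move=> t't [C C0 hC]; exists C => // u v u0 uv vt'.
by rewrite hC// (le_trans vt').
Qed.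

Lemma lipschitz_on_sub t t' f : t' <= t -> lipschitz_on t f -> lipschitz_on t' f.
Proof.
move=> t't [C C0 hC]; exists C => // u v u0 uv vt'.
by rewrite hC// (le_trans vt').
Qed.

Lemma eq_stieltjes_primitive t F F' f f' g g' :
  (forall u, 0 <= u -> u <= t -> [/\ F u = F' u, f u = f' u &
     g u - g 0 = g' u - g' 0]) ->
  stieltjes_primitive t F f g -> stieltjes_primitive t F' f' g'.
Proof.
move=> E [C C0 hC]; exists C => // u v u0 uv vt.
have [Fu fu gu] := E u u0 (le_trans uv vt).
have [Fv fv gv] := E v (le_trans u0 uv) vt.
have -> : g' v - g' u = (g' v - g' 0) - (g' u - g' 0) by ring.
rewrite -Fu -Fv -fu -gu -gv.
have -> : g v - g 0 - (g u - g 0) = g v - g u by ring.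
exact: hC.
Qed.

Lemma stieltjes_primitive_sum t (I : Type) (s : seq I) (F f : I -> R -> R) g :
  (forall i, stieltjes_primitive t (F i) (f i) g) ->
  stieltjes_primitive t (fun u => \sum_(i <- s) F i u)
    (fun u => \sum_(i <- s) f i u) g.
Proof.
move=> hF; elim: s => [|i s [C C0 hC]].
  exists 0 => // u v u0 uv vt.
  by rewrite !big_nil !subrr !mul0r subrr normr0.
have [D D0 hD] := hF i; exists (D + C); first exact: addr_ge0.
move=> u v u0 uv vt; rewrite !big_cons.
set a := \sum_(_ <- _) _; set a' := \sum_(_ <- _) _; set c := \sum_(_ <- _) _.
have -> : F i v + a - (F i u + a') - (f i u + c) * (g v - g u) =
  (F i v - F i u - f i u * (g v - g u)) + (a - a' - c * (g v - g u)) by ring.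
by rewrite (le_trans (ler_normD _ _))// [leRHS]mulrDl lerD// ?hD ?hC.
Qed.

Lemma monomial_primitive t k : lipschitz_on t (fun v => v ^+ k) /\
  stieltjes_primitive t (fun v => v ^+ k.+1) (fun v => k.+1%:R * v ^+ k) id.
Proof.
have lid : lipschitz_on t id.
  by exists 1 => // u v _ uv _; rewrite mul1r ger0_norm ?subr_ge0.
have pid : stieltjes_primitive t id (cst 1) id.
  by exists 0 => // u v _ _ _; rewrite /= mul1r subrr normr0 mul0r.
elim: k => [|k [lk pk]]; split.
- by exists 0 => // u v _ _ _; rewrite !expr0 subrr normr0 mul0r.
- apply: eq_stieltjes_primitive pid => u _ _; split => //.
  by rewrite expr0 mulr1.
- apply: stieltjes_primitive_lipschitz pk => //.
  have [C C0 hC] := lk; exists (k.+1%:R * C); first exact: mulr_ge0.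
  move=> u v u0 uv vt; rewrite -mulrBr normrM ger0_norm// -mulrA.
  by rewrite ler_wpM2l// hC.
- have lk1 : lipschitz_on t (fun v => v ^+ k.+1).
    apply: stieltjes_primitive_lipschitz pk => //.
    have [C C0 hC] := lk; exists (k.+1%:R * C); first exact: mulr_ge0.
    move=> u v u0 uv vt; rewrite -mulrBr normrM ger0_norm// -mulrA.
    by rewrite ler_wpM2l// hC.
  have [C C0 hC] := stieltjes_primitiveM lk1 lid pk pid.
  exists C => // u v u0 uv vt; move: (hC u v u0 uv vt); rewrite /=.
  congr (`|_| <= _).
  by rewrite !exprSr -[k.+2%:R]natr1; ring.
Qed.

(** The nodes are stopped at t, instead of subdividing [0, t], so that they are
    measurable functions of the path when t is its stopping time. *)
Definition stopped_riemann_sum t f g v n : R :=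
  let x k := Num.min (k%:R / n.+1%:R * v) t in
  \sum_(0 <= k < n.+1) f (x k) * (g (x k.+1) - g (x k)).

Lemma stopped_riemann_sum_cvg t F f g v : 0 <= t -> 0 <= v ->
  stieltjes_primitive t F f g ->
  stopped_riemann_sum t f g v n @[n --> \oo] --> F (Num.min v t) - F 0.
Proof.
move=> t0 v0 [C C0 hC]; apply/subr_cvg0.
have h0 : C * v ^+ 2 * n.+1%:R^-1 @[n --> \oo] --> (0 : R).
  rewrite -[X in _ --> X](mulr0 (C * v ^+ 2)).
  by apply: cvgM; [exact: cvg_cst|exact: cvg_harmonic].
apply/norm_cvg0P.
apply: (@squeeze_cvgr _ _ _ _ (cst 0) (fun n => C * v ^+ 2 * n.+1%:R^-1)) => //;
  last exact: cvg_cst.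
near=> n; rewrite normr_ge0 /=.
rewrite /stopped_riemann_sum /=; set x := fun k : nat => Num.min (k%:R / n.+1%:R * v) t.
have n0 : 0 < n.+1%:R :> R by [].
have -> : F (Num.min v t) - F 0 = \sum_(0 <= k < n.+1) (F (x k.+1) - F (x k)).
  rewrite (telescope_sumr (F \o x))//= /x divff ?lt0r_neq0// mul1r !mul0r.
  by rewrite (min_l t0).
rewrite -sumrB (le_trans (ler_norm_sum _ _ _))//.
have -> : C * v ^+ 2 * n.+1%:R^-1 = \sum_(0 <= k < n.+1) C * (v / n.+1%:R) ^+ 2.
  rewrite sumr_const_nat subn0 -[RHS]mulr_natr; field.
  by rewrite lt0r_neq0.
apply: ler_sum_nat => k /= kn.
have y0 : 0 <= k%:R / n.+1%:R * v by rewrite !mulr_ge0.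
have yS : k.+1%:R / n.+1%:R * v = k%:R / n.+1%:R * v + v / n.+1%:R.
  by rewrite -natr1; ring.
have d0 : 0 <= v / n.+1%:R by rewrite divr_ge0.
have [x0 xx xt xd] : [/\ 0 <= x k, x k <= x k.+1, x k.+1 <= t &
    x k.+1 - x k <= v / n.+1%:R].
  rewrite /x yS; move: (k%:R / n.+1%:R * v) (v / n.+1%:R) y0 d0 => y d y0 d0.
  by case: (leP y t) => ?; case: (leP (y + d) t) => ?; split; lra.
rewrite distrC (le_trans (hC _ _ x0 xx xt))// ler_wpM2l//.
by rewrite ler_sqr// nnegrE subr_ge0.
Unshelve. all: by end_near. Qed.

End PrimitiveCalculus.

(** * Iterated integrals and the shuffle identity *)

Fixpoint shuffle (A : Type) (s : seq A) : seq A -> seq (seq A) :=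
  fix shuffle_s (r : seq A) : seq (seq A) :=
    match s, r with
    | [::], _ => [:: r]
    | _, [::] => [:: s]
    | x :: s', y :: r' =>
        map (cons x) (shuffle s' r) ++ map (cons y) (shuffle_s r')
    end.

Lemma shuffle_cons (A : Type) (x y : A) s r : shuffle (x :: s) (y :: r) =
  map (cons x) (shuffle s (y :: r)) ++ map (cons y) (shuffle (x :: s) r).
Proof. by []. Qed.

Section IteratedIntegrals.
Context {R : realType} {m : nat}.
Variables (n : nat) (knot : nat -> R) (t : R) (Y : R -> 'rV[R]_m)
  (b : 'I_m -> nat -> R).
Hypothesis knot_incr : forall j, (j < n)%N -> knot j <= knot j.+1.
Hypothesis knot_ge0 : forall j, 0 <= knot j.
Hypothesis t_ge0 : 0 <= t.
Hypothesis Y_slopes : forall i (u : R), 0 <= u -> u <= t ->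
  Y u 0 i = Y 0 0 i + slope_sum n knot (b i) id u.

Implicit Types (i : 'I_m) (I J : seq 'I_m) (u v : R).
Local Notation S := (iterated_integral Y).
Local Notation g := (fun i => slope_sum n knot (b i) id).

Lemma iterated_integral_slope_sum i I H : lipschitz_on t (S I) ->
  (exists2 C : R, 0 <= C & forall u v, 0 <= u -> u <= v -> v <= t ->
    `|H v - H u - S I u * (v - u)| <= C * (v - u) ^+ 2) ->
  forall u, 0 <= u -> u <= t -> S (i :: I) u = slope_sum n knot (b i) H u.
Proof.
move=> lI qH u u0 ut /=.
have gE v : 0 <= v -> v <= t -> g i v - g i 0 = Y v 0 i - Y 0 0 i.
  by move=> v0 vt; rewrite slope_sum0// subr0 (Y_slopes i v0 vt) addrAC subrr add0r.
have lY : lipschitz_on t (fun v => Y v 0 i).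
  have [C C0 hC] := slope_sum_lipschitz knot_incr t (b i).
  exists C => // x y x0 xy yt.
  have gx := gE x x0 (le_trans xy yt); have gy := gE y (le_trans x0 xy) yt.
  have -> : Y y 0 i - Y x 0 i = g i y - g i x by lra.
  exact: hC.
have pF := slope_sum_primitive knot_incr (b i) lI qH.
have pY : stieltjes_primitive t (slope_sum n knot (b i) H) (S I) (fun v => Y v 0 i).
  by apply: eq_stieltjes_primitive pF => v v0 vt; split=> //; exact: gE.
rewrite (@RS_integral_primitive _ u (slope_sum n knot (b i) H))//.
- by rewrite slope_sum0// subr0.
- exact: lipschitz_on_sub lI.
- exact: lipschitz_on_sub lY.
- exact: stieltjes_primitive_sub pY.
Qed.

(** The integral of a Lipschitz integrand against a piecewise linear path is
    again given by slopes, applied to an antiderivative of the integrand. *)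
Lemma iterated_integral_step i I : lipschitz_on t (S I) ->
  stieltjes_primitive t (S (i :: I)) (S I) (g i) /\ S (i :: I) 0 = 0.
Proof.
move=> lI; have [H qH] := lipschitz_antiderivative lI.
have SE := iterated_integral_slope_sum i lI qH.
have pF := slope_sum_primitive knot_incr (b i) lI qH; split.
  by apply: eq_stieltjes_primitive pF => v v0 vt; split=> //; rewrite SE.
by rewrite SE// slope_sum0.
Qed.

Lemma iterated_integral_lipschitz I : lipschitz_on t (S I).
Proof.
elim: I => [|i I IH]; first by exists 0 => // u v _ _ _; rewrite subrr normr0 mul0r.
have [pS _] := iterated_integral_step i IH.
exact: stieltjes_primitive_lipschitz IH (slope_sum_lipschitz knot_incr t (b i)) pS.
Qed.

Lemma iterated_integral_primitive i I :
  stieltjes_primitive t (S (i :: I)) (S I) (g i).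
Proof. by have [] := iterated_integral_step i (iterated_integral_lipschitz I). Qed.

Lemma iterated_integral0 i I : S (i :: I) 0 = 0.
Proof. by have [] := iterated_integral_step i (iterated_integral_lipschitz I). Qed.

Lemma iterated_integral_le (V : R) I :
  (forall i, slope_variation n knot (b i) t <= V) ->
  forall u, 0 <= u -> u <= t -> `|S I u| <= V ^+ size I.
Proof.
move=> bV; elim: I => [|i I IH] u u0 ut; first by rewrite /= normr1 expr0.
have := primitive_le_variation knot_incr knot_ge0 (iterated_integral_primitive i I) IH u0 ut.
rewrite iterated_integral0 subr0 => /le_trans; apply.
rewrite exprSr ler_wpM2l//; first exact: le_trans (IH u u0 ut).
by rewrite (le_trans _ (bV i))// slope_variation_nd.
Qed.

(** Integration by parts: by induction on the two words, both sides have the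
    same differential, and they vanish at 0. *)
Lemma iterated_integralM I J u : 0 <= u -> u <= t ->
  S I u * S J u = \sum_(K <- shuffle I J) S K u.
Proof.
elim: I J u => [|i I IHI] J; first by case: J => [|j J] u _ _; rewrite /= big_seq1 mul1r.
elim: J => [|j J IHJ] u u0 ut; first by rewrite /= big_seq1 mulr1.
have [C C0 hC] := stieltjes_primitiveM (iterated_integral_lipschitz (i :: I))
  (iterated_integral_lipschitz (j :: J)) (iterated_integral_primitive i I)
  (iterated_integral_primitive j J).
have [C1 C10 hC1] := stieltjes_primitive_sum (shuffle I (j :: J))
  (iterated_integral_primitive i).
have [C2 C20 hC2] := stieltjes_primitive_sum (shuffle (i :: I) J)
  (iterated_integral_primitive j).
pose D v := S (i :: I) v * S (j :: J) v -
  \sum_(K <- shuffle I (j :: J)) S (i :: K) v -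
  \sum_(K <- shuffle (i :: I) J) S (j :: K) v.
have D0 : D 0 = 0.
  rewrite /D !iterated_integral0 mul0r !big1 ?subrr// => K _;
  exact: iterated_integral0.
have : `|D u - D 0| <= cst 0 u - cst 0 (0 : R).
  apply: (@quadratic_control _ u (C + C1 + C2) D) => // x y x0 xy yu.
  have yt := le_trans yu ut; have xt := le_trans xy yt.
  have {}hC := hC x y x0 xy yt.
  have {}hC1 := hC1 x y x0 xy yt; have {}hC2 := hC2 x y x0 xy yt.
  rewrite subrr add0r -IHI// in hC1 *; rewrite -IHJ// in hC2.
  rewrite [leRHS]mulrDl [in leRHS]mulrDl.
  set a := (X in `|X| <= _) in hC; set a1 := (X in `|X| <= _) in hC1.
  set a2 := (X in `|X| <= _) in hC2.
  have -> : D y - D x = a - a1 - a2 by rewrite /D /a /a1 /a2; ring.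
  rewrite (le_trans (ler_normB _ _))// lerD//.
  by rewrite (le_trans (ler_normB _ _))// lerD.
rewrite D0 !subr0 normr_le0 => /eqP DE.
rewrite shuffle_cons.
have -> : \sum_(K <- map (cons i) (shuffle I (j :: J)) ++
      map (cons j) (shuffle (i :: I) J)) S K u =
    \sum_(K <- shuffle I (j :: J)) S (i :: K) u +
    \sum_(K <- shuffle (i :: I) J) S (j :: K) u.
  by rewrite big_cat !big_map.
by apply/eqP; rewrite -subr_eq0; apply/eqP; rewrite -[RHS]DE /D; ring.
Qed.

Variable i0 : 'I_m.
Hypothesis time_coordinate : forall u : R, 0 <= u -> u <= t -> g i0 u = u.

Let divided_power k v : R := v ^+ k / k`!%:R.

Lemma divided_power_primitive k : exists2 C : R, 0 <= C &
  forall u v, 0 <= u -> u <= v -> v <= t ->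
    `|divided_power k.+1 v - divided_power k.+1 u - divided_power k u * (v - u)|
    <= C * (v - u) ^+ 2.
Proof.
have [_ [C C0 hC]] := monomial_primitive t k.
exists (C / k.+1`!%:R); first by rewrite divr_ge0.
move=> u v u0 uv vt; rewrite /divided_power.
have f0 : k`!%:R != 0 :> R by rewrite pnatr_eq0 -lt0n fact_gt0.
have -> : v ^+ k.+1 / k.+1`!%:R - u ^+ k.+1 / k.+1`!%:R - u ^+ k / k`!%:R * (v - u)
    = (v ^+ k.+1 - u ^+ k.+1 - k.+1%:R * u ^+ k * (v - u)) / k.+1`!%:R.
  rewrite factS natrM; have : k.+1%:R != 0 :> R by rewrite pnatr_eq0.
  by move: (k.+1%:R : R) => a a0; field; rewrite f0 a0.
rewrite normrM normfV normr_nat [leRHS]mulrAC ler_wpM2r ?invr_ge0//.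
exact: (hC u v u0 uv vt).
Qed.

Lemma iterated_integral_time k u : 0 <= u -> u <= t ->
  S (nseq k i0) u = divided_power k u.
Proof.
elim: k u => [|k IH] u u0 ut; first by rewrite /= /divided_power expr0 fact0 divr1.
apply: (stieltjes_primitive_unique (iterated_integral_primitive i0 (nseq k i0)))
  => //; last first.
  by rewrite iterated_integral0 /divided_power expr0n mul0r.
have [C C0 hC] := divided_power_primitive k.
exists C => // x y x0 xy yt; rewrite IH ?(le_trans xy)//.
by rewrite !time_coordinate ?(le_trans xy)// ?(le_trans x0)//; exact: hC.
Qed.

(** Time integrated k times is a divided power, so that one more integration
    against coordinate i gives a moment of that coordinate. *)
Lemma iterated_integral_moment i k u : 0 <= u -> u <= t ->
  S (i :: nseq k i0) u =
  slope_sum n knot (b i) (fun v => v ^+ k.+1 / k.+1`!%:R) u.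
Proof.
apply: iterated_integral_slope_sum; first exact: iterated_integral_lipschitz.
have [C C0 hC] := divided_power_primitive k.
exists C => // x y x0 xy yt; rewrite iterated_integral_time ?(le_trans xy)//.
exact: hC.
Qed.

End IteratedIntegrals.

(** * Slopes of stopped paths *)

Section SlopesOfPaths.
Context {R : realType}.
Variables (n : nat) (knot : nat -> R).
Hypothesis knot_incr : forall j, (j < n)%N -> knot j <= knot j.+1.
Implicit Types (u v : R) (b : nat -> R).

Lemma knot_le i j : (i <= j)%N -> (j <= n)%N -> knot i <= knot j.
Proof.
elim: j => [|j IH]; first by rewrite leqn0 => /eqP ->.
rewrite leq_eqVlt => /predU1P[->//|ij] jn.
by rewrite (le_trans (IH _ (ltnW jn)))// knot_incr.
Qed.

Lemma slope_sum_local b k u v : (k < n)%N -> knot k <= u -> u <= v ->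
  v <= knot k.+1 -> slope_sum n knot b id v - slope_sum n knot b id u = b k * (v - u).
Proof.
move=> kn ku uv vk; rewrite slope_sum_increment// (bigD1 (Ordinal kn))//= big1.
  by rewrite addr0 (min_r vk) (max_r uv) (min_l (le_trans ku uv)) (max_l ku).
move=> l; rewrite -val_eqE /= neq_ltn => /orP[lk|kl].
- have h1 : knot l.+1 <= u by apply: le_trans ku; apply: knot_le => //; exact: ltnW.
  have h0 : knot l <= u by apply: le_trans h1; exact: knot_incr.
  by rewrite !(min_l (le_trans _ uv))// !max_l// subrr mulr0.
- have h0 : v <= knot l by apply: (le_trans vk); apply: knot_le => //; exact: ltnW.
  have h1 : v <= knot l.+1 by apply: (le_trans h0); exact: knot_incr.
  by rewrite !min_r// subrr mulr0.
Qed.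

(** Slopes after time t do not influence the path on [0, t]; this permits to
    normalize them to 0. *)
Lemma slope_sum_truncate b b' t u : u <= t ->
  (forall j, (j < n)%N -> knot j < t -> b j = b' j) ->
  slope_sum n knot b id u = slope_sum n knot b' id u.
Proof.
move=> ut bb'; apply: eq_bigr => j _; have [tj|tj] := ltP (knot j) t.
  by rewrite bb'.
have h0 := le_trans ut tj; have h1 := le_trans h0 (knot_incr (ltn_ord j)).
by rewrite !min_r// subrr !mulr0.
Qed.

End SlopesOfPaths.

Section StoppedPaths.
Context {R : realType} {d : nat}.
Variables (T : R) (x0 : 'rV[R]_d) (ts : seq R).
Hypothesis T_gt0 : 0 < T.
Hypothesis hts : itv_partition 0 T ts.

Definition node j : R := (0 :: ts)`_j.
Local Notation n := (size ts).

Lemma node_lt j : (j < n)%N -> node j < node j.+1.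
Proof. by move=> jn; have [] := itv_partition_nth hts jn. Qed.

Lemma node_incr j : (j < n)%N -> node j <= node j.+1.
Proof. by move=> /node_lt/ltW. Qed.

Lemma node_ge0 j : 0 <= node j.
Proof.
case: j => [|j]; first exact: lexx.
have [jn|jn] := ltnP j n; last by rewrite /node /= nth_default.
by have [p0 ps _] := itv_partition_nth hts jn; rewrite (le_trans p0)// ltW.
Qed.

Lemma node_last : node n = T.
Proof. by have := itv_partition_nth_size 0 hts. Qed.

Lemma size_partition_gt0 : (0 < n)%N.
Proof.
case: ts hts => // /itv_partition_nil T0.
by move: T_gt0; rewrite -T0 ltxx.
Qed.

Lemma node_cover u : 0 <= u -> u <= T ->
  exists2 k, (k < n)%N & node k <= u <= node k.+1.
Proof.
move=> u0 uT.
have : exists k, u <= node k by exists n; rewrite node_last.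
move=> /ex_minnP[[|k] uk kmin].
  by exists 0%N; rewrite ?u0 ?(le_trans uk) ?node_incr// size_partition_gt0.
exists k.
  by have := kmin n; rewrite node_last; apply.
rewrite uk andbT leNgt; apply/negP => /ltW/kmin.
by rewrite ltnn.
Qed.

(** Both sides agree at the nodes, by telescoping, and are affine in between. *)
Lemma interpolate_slopes (X : R -> 'rV[R]_d) i u : 0 <= u -> u <= T ->
  interpolate ts X u 0 i = X 0 0 i + slope_sum n node
    (fun j => (X (node j.+1) 0 i - X (node j) 0 i) / (node j.+1 - node j)) id u.
Proof.
move=> u0 uT; set b := fun j => _.
have at_node k : (k <= n)%N ->
    slope_sum n node b id (node k) = X (node k) 0 i - X 0 0 i.
  elim: k => [_|k IH kn]; first by rewrite [node 0]/= slope_sum0 ?subrr//; exact: node_ge0.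
  have := slope_sum_local node_incr b kn (lexx _) (node_incr kn) (lexx _).
  rewrite IH ?(ltnW kn)// /b divfK; last by rewrite subr_eq0 gt_eqF// node_lt.
  by lra.
have [k kn /andP[ku uk]] := node_cover u0 uT.
rewrite (interpolateE _ hts kn); last by rewrite ku.
have := slope_sum_local node_incr b kn (lexx _) ku uk.
rewrite at_node ?(ltnW kn)// !mxE /b -/(node k) -/(node k.+1).
set e := node k.+1 - node k; move=> h.
have -> : slope_sum n node b id u = X (node k) 0 i - X 0 0 i +
   (X (node k.+1) 0 i - X (node k) 0 i) / e * (u - node k) by lra.
by ring.
Qed.

Implicit Types (u : R) (w v : R * (R -> 'rV[R]_(1 + d))) (b : 'I_(1 + d) -> nat -> R).

Definition time_index : 'I_(1 + d) := lshift d ord0.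

(** The slopes are right slopes, set to 0 from the stopping time on. With this
    convention they are unique, they are measurable functions of the stopped
    path, and together with the stopping time they determine it continuously. *)
Definition slopes_of w b :=
  [/\ 0 <= w.1 <= T,
   forall i u, 0 <= u -> u <= w.1 ->
     w.2 u 0 i = row_mx 0 x0 0 i + slope_sum n node (b i) id u,
   forall u, 0 <= u -> u <= w.1 -> slope_sum n node (b time_index) id u = u &
   forall i j, (j < n)%N -> w.1 <= node j -> b i j = 0].

Lemma slope_sum1 u : 0 <= u -> u <= T -> slope_sum n node (fun=> 1) id u = u.
Proof.
move=> u0 uT; rewrite /slope_sum.
under eq_bigr do rewrite mul1r.
rewrite -(big_mkord xpredT (fun j => Num.min (node j.+1) u - Num.min (node j) u)).
rewrite (telescope_sumr (fun j => Num.min (node j) u))//.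
by rewrite node_last (min_r uT) /node /= (min_l u0) subr0.
Qed.

Lemma stopped_set_slopes w : stopped_set T x0 ts w -> exists b, slopes_of w b.
Proof.
move=> [/andP[w0 wT] [Y [X X0 YE] wE]].
have wX u : 0 <= u -> u <= w.1 -> w.2 u = row_mx u%:M (interpolate ts X u).
  move=> u0 uw; by rewrite wE YE /patch !mem_set//= in_itv /= u0 ?(le_trans uw).
pose c j : 'rV[R]_d := (node j.+1 - node j)^-1 *: (X (node j.+1) - X (node j)).
pose b i j : R := if node j < w.1 then (row_mx 1%:M (c j) : 'rV[R]_(1 + d)) 0 i else 0.
have bE i u : u <= w.1 -> slope_sum n node (b i) id u =
    slope_sum n node (fun j => (row_mx 1%:M (c j) : 'rV[R]_(1 + d)) 0 i) id u.
  by move=> uw; apply: (slope_sum_truncate node_incr uw) => j _ jw; rewrite /b jw.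
have b_time u : 0 <= u -> u <= w.1 -> slope_sum n node (b time_index) id u = u.
  move=> u0 uw; rewrite bE//.
  under [X in slope_sum _ _ X]funext => j do rewrite row_mxEl mxE eqxx mulr1n.
  by apply: slope_sum1 => //; exact: le_trans wT.
exists b; split=> //; first by rewrite w0 wT.
- move=> i u u0 uw; rewrite wX//; case: (split_ordP i) => k ->.
    rewrite !row_mxEl (ord1 k) !mxE eqxx mulr1n add0r.
    by rewrite b_time.
  rewrite !row_mxEr bE// (interpolate_slopes X k u0 (le_trans uw wT)) X0.
  congr (_ + slope_sum _ _ _ _ _); apply/funext => j.
  by rewrite row_mxEr !mxE mulrC.
- by move=> i j _ wj; rewrite /b ltNge wj.
Qed.

Definition stopped_value w u i : R :=
  w.2 (Num.min u w.1) 0 i.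

Lemma stopped_valueE w b u i : slopes_of w b -> 0 <= u ->
  stopped_value w u i = row_mx 0 x0 0 i + slope_sum n node (b i) id (Num.min u w.1).
Proof.
move=> [/andP[w0 wT] wb _ _] u0; apply: wb; first by rewrite le_min u0.
by rewrite ge_min lexx orbT.
Qed.

Lemma stopped_path_space w u k :
  stopped_path w u 0 (rshift 1 k) = stopped_value w u (rshift 1 k).
Proof. by rewrite row_mxEr mxE. Qed.

Lemma stopped_path_time w u k : stopped_path w u 0 (lshift d k) = u.
Proof. by rewrite row_mxEl (ord1 k) mxE eqxx mulr1n. Qed.

End StoppedPaths.

(** * The metric of stopped paths in terms of slopes *)

Section EuclideanNormBounds.
Context {R : realType} {m : nat}.
Implicit Types u v : 'rV[R]_m.

Lemma coordB u v i : (u - v) 0 i = u 0 i - v 0 i.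
Proof. by rewrite !mxE. Qed.

Lemma coord_le_enorm u i : `|u 0 i| <= enorm u.
Proof.
rewrite -sqrtr_sqr ler_wsqrtr// (bigD1 i)//= lerDl.
by apply: sumr_ge0 => j _; exact: sqr_ge0.
Qed.

Lemma enorm_le_sum u : enorm u <= \sum_(i < m) `|u 0 i|.
Proof.
have s0 : 0 <= \sum_(i < m) `|u 0 i| by exact: sumr_ge0.
rewrite -[leRHS]ger0_norm// -sqrtr_sqr ler_wsqrtr// expr2 mulr_suml.
apply: ler_sum => i _; rewrite mulr_sumr (bigD1 i)//= -normrM -expr2.
rewrite ger0_norm ?sqr_ge0// lerDl.
by apply: sumr_ge0 => j _; exact: mulr_ge0.
Qed.

End EuclideanNormBounds.

(** Interpolation between the trivial bounds; it turns an increment that is both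
    short and small into a small Hoelder quotient. *)
Lemma min_le_powR (R : realType) (p q a : R) : 0 <= p -> 0 <= q -> 0 <= a ->
  a <= 1 -> Num.min p q <= p `^ a * q `^ (1 - a).
Proof.
move=> p0 q0 a0 a1.
have m0 : 0 <= Num.min p q by rewrite le_min p0.
have [->|mneq0] := eqVneq (Num.min p q) 0; first by rewrite mulr_ge0 ?powR_ge0.
have -> : Num.min p q = Num.min p q `^ a * Num.min p q `^ (1 - a).
  rewrite -powRD ?(addrC a) ?subrK ?powRr1//.
  by rewrite mneq0 implybT.
rewrite ler_pM ?powR_ge0// ge0_ler_powR ?nnegrE ?subr_ge0//.
  by rewrite ge_min lexx.
by rewrite ge_min lexx orbT.
Qed.

Section StoppedDistance.
Context {R : realType} {d : nat}.
Variables (T : R) (x0 : 'rV[R]_d) (ts : seq R) (a : R).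
Hypothesis T_gt0 : 0 < T.
Hypothesis hts : itv_partition 0 T ts.
Hypothesis a_ge0 : 0 <= a.
Hypothesis a_lt1 : a < 1.
Local Notation n := (size ts).
Local Notation node := (node ts).
Implicit Types (w v : R * (R -> 'rV[R]_(1 + d))) (b c : 'I_(1 + d) -> nat -> R).

Let ell j (r : R) := Num.min (node j.+1) r - Num.min (node j) r.

Lemma stopped_segment_increment j x y t : (j < n)%N -> x <= y ->
  0 <= ell j (Num.min y t) - ell j (Num.min x t) <= y - x.
Proof.
move=> jn xy.
have [xy0 xyd] : Num.min x t <= Num.min y t /\
    Num.min y t - Num.min x t <= y - x.
  by case: (leP x t) => ?; case: (leP y t) => ?; split; lra.
move: (Num.min x t) (Num.min y t) xy0 xyd => p q pq pqd.
have [h1 h2 h3] := clamp_bounds pq (node_incr hts jn).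
have := min_increment (node j.+1) id pq; have := min_increment (node j) id pq.
rewrite /ell /=; lra.
Qed.

Lemma segment_stopping j x s t : (j < n)%N ->
  `|ell j (Num.min x s) - ell j (Num.min x t)| <= `|s - t|.
Proof.
move=> jn; wlog st : s t / s <= t.
  move=> h; have [/h//|/ltW/h] := leP s t.
  by rewrite distrC [`|t - s|]distrC.
have := stopped_segment_increment x jn st.
rewrite ![Num.min _ x]minC => /andP[h0 h1].
rewrite distrC ger0_norm// distrC ger0_norm// subr_ge0//.
Qed.

(** Changing the stopping time costs the slopes of w over a time at most
    |w.1 - v.1|, changing the slopes costs their difference over y - x. *)
Lemma stopped_value_diff w v b c i x y : slopes_of T x0 ts w b ->
  slopes_of T x0 ts v c -> 0 <= x -> x <= y ->
  `|(stopped_value w y i - stopped_value v y i) -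
    (stopped_value w x i - stopped_value v x i)| <=
  \sum_(j < n) (2 * `|b i j| * Num.min (y - x) `|w.1 - v.1| +
                `|b i j - c i j| * (y - x)).
Proof.
move=> wb vc x0' xy; have y0 := le_trans x0' xy.
rewrite !(stopped_valueE i wb)// !(stopped_valueE i vc)//.
rewrite /slope_sum /=.
set k := row_mx _ _ _ _; set s1 := \sum_(_ < _) _; set s2 := \sum_(_ < _) _.
set s3 := \sum_(_ < _) _; set s4 := \sum_(_ < _) _.
have -> : k + s1 - (k + s2) - (k + s3 - (k + s4)) = (s1 - s3) - (s2 - s4) by ring.
rewrite -!sumrB (le_trans (ler_norm_sum _ _ _))//; apply: ler_sum => j _.
have jn := ltn_ord j.
have := stopped_segment_increment w.1 jn xy.
have := stopped_segment_increment v.1 jn xy.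
have := segment_stopping y w.1 v.1 jn; have := segment_stopping x w.1 v.1 jn.
rewrite /ell.
set h := Num.min (node j.+1) _ - _; set h' := Num.min (node j.+1) (Num.min x v.1) - _.
move=> hx.
set g := Num.min (node j.+1) _ - _; set g' := Num.min (node j.+1) (Num.min y v.1) - _.
move=> hy /andP[v0 v1] /andP[w0 w1].
have -> : b i j * g - b i j * h - (c i j * g' - c i j * h') =
  b i j * ((g - h) - (g' - h')) + (b i j - c i j) * (g' - h') by ring.
rewrite (le_trans (ler_normD _ _))// !normrM lerD//; last first.
  by rewrite ler_wpM2l// ger0_norm.
rewrite [2 * _]mulrC -mulrA ler_wpM2l//.
move: hx hy; rewrite !ler_norml => /andP[? ?] /andP[? ?].
by case: (leP (y - x) `|w.1 - v.1|) => ?; apply/andP; split; lra.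
Qed.

Lemma holder_dist_slopes w v b c : slopes_of T x0 ts w b ->
  slopes_of T x0 ts v c ->
  (holder_dist T a (stopped_path w) (stopped_path v) <=
  (\sum_(i < 1 + d) \sum_(j < n) (2 * `|b i j| * `|w.1 - v.1| `^ (1 - a) +
     `|b i j - c i j| * T `^ (1 - a)))%:E)%E.
Proof.
move=> wb vc; apply: ge_ereal_sup => _ [[x y] /= [x0' xy yT] <-].
rewrite lee_fin ler_pdivrMr; last by rewrite powR_gt0// normr_gt0 subr_eq0 gt_eqF.
rewrite (le_trans (enorm_le_sum _))// mulr_suml; apply: ler_sum => i _.
have yx0 : 0 <= y - x by rewrite subr_ge0 ltW.
rewrite [`|y - x|]ger0_norm// mulr_suml.
case: (split_ordP i) => k iE.
  rewrite iE /= !coordB !stopped_path_time !subrr normr0.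
  by apply: sumr_ge0 => j _; rewrite mulr_ge0 ?powR_ge0// addr_ge0// !mulr_ge0// powR_ge0.
have -> : ((stopped_path w \- stopped_path v) y - (stopped_path w \- stopped_path v) x) 0 i =
  (stopped_value w y i - stopped_value v y i) -
    (stopped_value w x i - stopped_value v x i).
  by rewrite iE /= !coordB !stopped_path_space.
rewrite (le_trans (stopped_value_diff i wb vc x0' (ltW xy)))//.
apply: ler_sum => j _; rewrite [leRHS]mulrDl lerD//.
  rewrite -!mulrA ler_wpM2l// ler_wpM2l// mulrC.
  by apply: min_le_powR => //; exact: ltW.
rewrite -mulrA ler_wpM2l//.
have yxT : y - x <= T by rewrite lerBlDr (le_trans yT)// lerDl.
have := min_le_powR yx0 (ltW T_gt0) a_ge0 (ltW a_lt1).
by rewrite (min_l yxT) [leRHS]mulrC.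
Qed.

End StoppedDistance.

Lemma holder_norm_ge0 (R : realType) m (T a : R) (Y : R -> 'rV[R]_m) : 0 < T ->
  (0 <= holder_norm T a Y)%E.
Proof.
move=> T0; apply: (@le_trans _ _ (enorm (Y T - Y 0) / `|T - 0| `^ a)%:E).
  by rewrite lee_fin divr_ge0 ?enorm_ge0 ?powR_ge0.
by apply: ereal_sup_ubound; exists (0, T) => //=; rewrite lexx T0.
Qed.

Section StoppedTopology.
Context {R : realType} {d : nat}.
Variables (T : R) (x0 : 'rV[R]_d) (ts : seq R) (a : R).
Hypothesis T_gt0 : 0 < T.
Hypothesis hts : itv_partition 0 T ts.
Local Notation n := (size ts).
Local Notation node := (node ts).
Implicit Types (w v : R * (R -> 'rV[R]_(1 + d))) (b c : 'I_(1 + d) -> nat -> R).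

(** The stopping time and the slopes determine the stopped path continuously.
    The condition a < 1 is essential: when the stopping time moves, a slope is
    kept for a short additional time only, which is small in the a-Hoelder
    sense but not in the Lipschitz sense. *)
Lemma stopped_dist_lt_slopes w b (e : R) : 0 <= a -> a < 1 ->
  slopes_of T x0 ts w b -> 0 < e ->
  exists2 r : R, 0 < r & forall v c, slopes_of T x0 ts v c ->
    `|w.1 - v.1| < r -> (forall i j, (j < n)%N -> `|b i j - c i j| < r) ->
    (stopped_dist T a w v < e%:E)%E.
Proof.
move=> a0 a1 wb e0.
have a1' : 0 < 1 - a by rewrite subr_gt0.
pose K := \sum_(i < 1 + d) \sum_(j < n) (2 * `|b i j| + T `^ (1 - a)).
have K0 : 0 <= K.
  by do 2 (apply: sumr_ge0 => ? _); rewrite addr_ge0 ?powR_ge0// mulr_ge0.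
pose q := e / (K + 2).
have q0 : 0 < q by rewrite divr_gt0// ltr_wpDl.
pose r := Num.min 1 (q `^ (1 - a)^-1).
have r0 : 0 < r by rewrite lt_min ltr01 powR_gt0.
have rq : r `^ (1 - a) <= q.
  have -> : q = (q `^ (1 - a)^-1) `^ (1 - a).
    by rewrite -powRrM mulVf ?gt_eqF// powRr1// ltW.
  by rewrite ge0_ler_powR ?nnegrE ?powR_ge0 ?(ltW r0) ?(ltW a1')// ge_min lexx orbT.
have rr : r <= r `^ (1 - a).
  have r1 : r <= 1 by rewrite ge_min lexx.
  by rewrite -{1}[r]powRr1 ?ger_powR ?r0//; [rewrite gerBl|exact: ltW].
exists r => // v c vc wv bc.
have hd := holder_dist_slopes T_gt0 hts a0 a1 wb vc.
apply: (@le_lt_trans _ _ (r `^ (1 - a) + K * r `^ (1 - a))%:E); last first.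
  rewrite lte_fin (@le_lt_trans _ _ ((K + 1) * q))//.
    by rewrite mulrDl mul1r addrC lerD// ler_wpM2l.
  by rewrite /q mulrCA -[ltRHS]mulr1 ltr_pM2l// ltr_pdivrMr ?ltr_wpDl// mul1r ltrD2l ltr1n.
rewrite /stopped_dist EFinD leeD//; first by rewrite lee_fin (le_trans _ rr)// ltW.
apply: (le_trans hd); rewrite lee_fin /K mulr_suml; apply: ler_sum => i _.
rewrite mulr_suml; apply: ler_sum => j _; rewrite [leRHS]mulrDl lerD//.
  rewrite ler_wpM2l ?mulr_ge0// ge0_ler_powR ?nnegrE ?(ltW r0) ?(ltW a1')//.
  exact: ltW.
rewrite [leRHS]mulrC ler_wpM2r ?powR_ge0// (le_trans _ rr)// ltW//.
exact: bc.
Qed.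

Lemma stopped_path_value w b u i : slopes_of T x0 ts w b ->
  0 <= u -> u <= w.1 -> stopped_path w u 0 i = w.2 u 0 i.
Proof.
move=> [_ wb wt _] u0 uw; case: (split_ordP i) => k ->.
  rewrite stopped_path_time wb// (ord1 k) wt// row_mxEl mxE add0r//.
by rewrite stopped_path_space /stopped_value min_l.
Qed.

(** Evaluation at a fixed time is Lipschitz for the metric, since all paths
    start at the same point. *)
Lemma stopped_value_dist w v b c (D : R) u i : 0 <= a ->
  slopes_of T x0 ts w b -> slopes_of T x0 ts v c ->
  (stopped_dist T a w v < D%:E)%E -> 0 <= u -> u <= T ->
  `|stopped_value w u i - stopped_value v u i| <= (T `^ a + 1) * D.
Proof.
move=> a0 wb vc wvD u0 uT.
have H0 : (0 <= holder_dist T a (stopped_path w) (stopped_path v))%E.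
  exact: holder_norm_ge0.
have tD : `|w.1 - v.1| <= D.
  by rewrite -lee_fin (le_trans _ (ltW wvD))// /stopped_dist leeDl.
have D0 : 0 <= D by exact: le_trans tD.
have HD : (holder_dist T a (stopped_path w) (stopped_path v) <= D%:E)%E.
  by rewrite (le_trans _ (ltW wvD))// /stopped_dist leeDr// lee_fin.
have Ta : 0 <= T `^ a by exact: powR_ge0.
have [wt vt] : w.1 <= T /\ v.1 <= T.
  by case: wb vc => [/andP[_ wT] _ _ _] [/andP[_ vT] _ _ _].
case: (split_ordP i) => k iE.
  have tE z c' : slopes_of T x0 ts z c' -> stopped_value z u i = Num.min u z.1.
    move=> zc; rewrite (stopped_valueE i zc)// iE (ord1 k).
    have [/andP[z0 zT] _ zt _] := zc.
    have m0 : 0 <= Num.min u z.1 by rewrite le_min u0.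
    have mz : Num.min u z.1 <= z.1 by rewrite ge_min lexx orbT.
    by rewrite (zt _ m0 mz) row_mxEl mxE add0r.
  rewrite (tE _ _ wb) (tE _ _ vc) (@le_trans _ _ D)//; last first.
    by rewrite ler_peMl// lerDr.
  rewrite (le_trans _ tD)//.
  by case: (leP u w.1) => ?; case: (leP u v.1) => ?; rewrite ler_norml;
    apply/andP; split; have := ler_norm (w.1 - v.1); have := ler_norm (v.1 - w.1);
    rewrite [`|v.1 - _|]distrC; lra.
have [->|uneq0] := eqVneq u 0.
  rewrite !(stopped_valueE i wb)// !(stopped_valueE i vc)//.
  have [/andP[w0 _] _ _ _] := wb; have [/andP[v0 _] _ _ _] := vc.
  rewrite !min_l// !slope_sum0; try by move=> j; exact: (node_ge0 hts).
  by rewrite subrr normr0 mulr_ge0// addr_ge0.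
have u_gt0 : 0 < u by rewrite lt_neqAle eq_sym uneq0.
have : ((enorm ((stopped_path w \- stopped_path v) u -
    (stopped_path w \- stopped_path v) 0) / `|u - 0| `^ a)%:E <= D%:E)%E.
  apply: le_trans HD; apply: ereal_sup_ubound; exists (0, u) => //=.
rewrite lee_fin subr0 gtr0_norm// ler_pdivrMr ?powR_gt0// => h.
have z0 : (stopped_path w \- stopped_path v) 0 0 i = 0.
  rewrite iE /= coordB !stopped_path_space -iE.
  rewrite !(stopped_valueE i wb)// !(stopped_valueE i vc)//.
  have [/andP[w0 _] _ _ _] := wb; have [/andP[v0 _] _ _ _] := vc.
  by rewrite !min_l// !slope_sum0 ?subrr//; move=> j; exact: (node_ge0 hts).
have -> : stopped_value w u i - stopped_value v u i =
    ((stopped_path w \- stopped_path v) u - (stopped_path w \- stopped_path v) 0) 0 i.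
  by rewrite coordB z0 subr0 iE /= coordB !stopped_path_space.
rewrite (le_trans (coord_le_enorm _ _))// (le_trans h)// mulrC ler_wpM2r//.
rewrite (@le_trans _ _ (T `^ a))// ?lerDl// ge0_ler_powR ?nnegrE// ltW//.
Qed.

(** The increment over each of the n intervals is at most T ^ al * M. *)
Lemma slope_variation_holder w b (al M : R) i : slopes_of T x0 ts w b ->
  0 <= al -> (holder_norm T al (stopped_path w) <= M%:E)%E ->
  slope_variation n node (b i) w.1 <= n%:R * (T `^ al * M).
Proof.
move=> wb al0 wM; have [/andP[w0 wT] wE wt wz] := wb.
have hM x y : 0 <= x -> x < y -> y <= w.1 ->
    `|w.2 y 0 i - w.2 x 0 i| <= T `^ al * M.
  move=> x0' xy yw.
  have yx : 0 < y - x by rewrite subr_gt0.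
  have : (((enorm (stopped_path w y - stopped_path w x)) / `|y - x| `^ al)%:E <= M%:E)%E.
    apply: le_trans wM; apply: ereal_sup_ubound; exists (x, y) => //=.
    by rewrite x0' xy (le_trans yw).
  rewrite lee_fin gtr0_norm// ler_pdivrMr ?powR_gt0// => h.
  have M0 : 0 <= M.
    by rewrite -(pmulr_lge0 M (powR_gt0 al yx)) (le_trans (enorm_ge0 _) h).
  rewrite -!(stopped_path_value i wb) ?(le_trans (ltW xy))// ?(le_trans x0' (ltW xy))//.
  rewrite -coordB (le_trans (coord_le_enorm _ _))// (le_trans h)// mulrC ler_wpM2r//.
  rewrite ge0_ler_powR ?nnegrE ?(ltW yx) ?(ltW T_gt0)// lerBlDr.
  by rewrite (le_trans yw)// (le_trans wT)// lerDl.
rewrite /slope_variation /slope_sum /=.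
apply: (@le_trans _ _ (\sum_(j < n) T `^ al * M)); last first.
  by rewrite sumr_const card_ord -[leLHS]mulr_natl.
apply: ler_sum => j _; have jn := ltn_ord j.
have nn := node_incr hts jn; have n0 := node_ge0 hts j.
have [jw|wj] := ltP (node j) w.1; last first.
  have wj1 := le_trans wj nn; rewrite !min_r// subrr mulr0.
  have [M0|M0] := leP 0 M; first by rewrite mulr_ge0// powR_ge0.
  suff : (0 <= M%:E)%E by rewrite lee_fin leNgt M0.
  by apply: le_trans wM; exact: holder_norm_ge0.
have jy : node j < Num.min (node j.+1) w.1 by rewrite lt_min jw andbT; exact: (node_lt hts).
have yw : Num.min (node j.+1) w.1 <= w.1 by rewrite ge_min lexx orbT.
have yn : Num.min (node j.+1) w.1 <= node j.+1 by rewrite ge_min lexx.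
rewrite -[X in _ * X]ger0_norm ?subr_ge0 ?(ltW jy)// -normrM.
rewrite -(slope_sum_local (node_incr hts) (b i) jn (lexx _) (ltW jy) yn).
have := hM _ _ n0 jy yw; rewrite !wE//.
- by rewrite opprD addrACA subrr add0r.
- exact: ltW.
- by rewrite (le_trans n0)// ltW.
Qed.

End StoppedTopology.

(** * Measurability of slopes and iterated integrals *)

Lemma cvgn_sum_ord (R : realType) n (f : 'I_n -> nat -> R) (l : 'I_n -> R) :
  (forall j, f j N @[N --> \oo] --> l j) ->
  \sum_(j < n) f j N @[N --> \oo] --> \sum_(j < n) l j.
Proof.
elim: n f l => [|n IH] f l fl.
  by under eq_fun do rewrite big_ord0; rewrite big_ord0; exact: cvg_cst.
under eq_fun do rewrite big_ord_recl /=; rewrite big_ord_recl.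
by apply: cvgD; [exact: fl|apply: (IH (fun j => f (lift ord0 j)))].
Qed.

Lemma measurable_sum_ord disp (S : measurableType disp) (R : realType) n
    (f : 'I_n -> S -> R) : (forall j, measurable_fun setT (f j)) ->
  measurable_fun setT (fun x => \sum_(j < n) f j x).
Proof.
elim: n f => [|n IH] f mf; first by under eq_fun do rewrite big_ord0; exact: measurable_cst.
under eq_fun do rewrite big_ord_recl /=.
by apply: measurable_funD => //; apply: (IH (fun j => f (lift ord0 j))).
Qed.

(** A set that is open for the topology defined by finitely many measurable
    functions is a countable union of preimages of rational boxes. *)
Lemma measurable_boxes disp (S : measurableType disp) (R : realType)
    (K : finType) (Phi : K -> S -> R) (U : set S) :
  (forall k, measurable_fun setT (Phi k)) ->
  (forall x, U x -> exists2 r : R, 0 < r &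
     forall y, (forall k, `|Phi k x - Phi k y| < r) -> U y) ->
  measurable U.
Proof.
move=> mPhi Uopen.
pose box (q : {ffun K -> rat} * rat) : set S :=
  \bigcap_(k in [set: K]) [set y | `|ratr (q.1 k) - Phi k y| < ratr q.2].
have mbox q : measurable (box q).
  apply: fin_bigcap_measurable => // k _.
  have mf : measurable_fun setT (fun y => `|ratr (q.1 k) - Phi k y|).
    apply: (measurableT_comp (@normr_measurable R setT)).
    exact: (measurable_funB (measurable_cst _) (mPhi k)).
  rewrite -[X in measurable X]setTI.
  have mb := measurable_fun_ltr mf (@measurable_cst _ _ S _ setT (ratr q.2 : R)).
  have mt : measurable [set true] by [].
  exact: (mb measurableT _ mt).
have -> : U = \bigcup_q (if `[< box q `<=` U >] then box q else set0).
  apply/seteqP; split=> [x Ux|x [q _]]; last by case: asboolP => // qU /qU.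
  have [r r0 hr] := Uopen x Ux.
  have r2 : 0 < r / 2 by rewrite divr_gt0.
  have [rho] := rat_in_itvoo r2; rewrite in_itv /= => /andP[rho0 rhor].
  have qex k : exists q : rat, `|ratr q - Phi k x| < ratr rho.
    have h0 : Phi k x - ratr rho < Phi k x + ratr rho by rewrite ltrD2l gtrN.
    have [q] := rat_in_itvoo h0.
    by rewrite in_itv /= => /andP[h1 h2]; exists q; rewrite ltr_distl h1.
  have [q hq] := choice qex.
  exists ([ffun k => q k], rho) => //.
  have xbox : box ([ffun k => q k], rho) x by move=> k _ /=; rewrite ffunE.
  rewrite (_ : `[< _ >] = true)//; apply/asboolP => y ybox.
  apply: hr => k; have := ybox k I; have := hq k; rewrite /= ffunE => h1 h2.
  have -> : Phi k x - Phi k y = (ratr (q k) - Phi k y) - (ratr (q k) - Phi k x) by ring.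
  by rewrite (le_lt_trans (ler_normB _ _))// (splitr r) ltrD// (lt_trans _ rhor).
apply: countable_bigcupT_measurable; first exact: countableP.
by move=> q; case: asboolP.
Qed.

Section MeasurableSlopes.
Context {R : realType} {d : nat}.
Variables (T : R) (x0 : 'rV[R]_d) (ts : seq R).
Hypothesis T_gt0 : 0 < T.
Hypothesis hts : itv_partition 0 T ts.
Local Notation n := (size ts).
Local Notation node := (node ts).
Context {disp} {S : measurableType disp}.
Variables (iota : S -> R * (R -> 'rV[R]_(1 + d)))
  (b : S -> 'I_(1 + d) -> nat -> R).
Hypothesis iota_slopes : forall x, slopes_of T x0 ts (iota x) (b x).
Hypothesis value_measurable : forall (u : R) i, 0 <= u ->
  measurable_fun setT (fun x => stopped_value (iota x) u i).

Local Notation tau := (fun x => (iota x).1).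
Implicit Types (x : S) (i : 'I_(1 + d)) (u v : R) (I : seq 'I_(1 + d)).

Let slope_sum_value x u i : 0 <= u ->
  slope_sum n node (b x i) id (Num.min u (tau x)) =
  stopped_value (iota x) u i - row_mx 0 x0 0 i.
Proof.
by move=> u0; rewrite (stopped_valueE i (iota_slopes x) u0) addrAC subrr add0r.
Qed.

Lemma measurable_slope_sum u i : 0 <= u -> measurable_fun setT
  (fun x => slope_sum n node (b x i) id (Num.min u (tau x))).
Proof.
move=> u0; under eq_fun do rewrite slope_sum_value//.
by apply: measurable_funB => //; exact: value_measurable.
Qed.

Lemma measurable_stopping_time : measurable_fun setT tau.
Proof.
have -> : tau = fun x => slope_sum n node (b x time_index) id (Num.min T (tau x)).
  apply/funext => x; have [/andP[t0 tT] _ tE _] := iota_slopes x.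
  by rewrite min_r// tE.
exact: measurable_slope_sum (ltW T_gt0).
Qed.

(** The slope is a limit of difference quotients at the node, from the right. *)
Lemma measurable_slope i j : (j < n)%N -> measurable_fun setT (fun x => b x i j).
Proof.
move=> jn; have j0 := node_ge0 hts j.
pose u N : R := node j + N.+1%:R^-1.
have u0 N : 0 <= u N by rewrite addr_ge0.
pose q N x := N.+1%:R * (slope_sum n node (b x i) id (Num.min (u N) (tau x)) -
  slope_sum n node (b x i) id (Num.min (node j) (tau x))).
have mq N : measurable_fun setT (q N).
  by apply: measurable_funM => //; apply: measurable_funB; exact: measurable_slope_sum.
apply: (measurable_fun_cvg mq) => x _.
have [/andP[t0 tT] _ _ bz] := iota_slopes x.
apply: cvg_near_cst.
have [jt|tj] := ltP (node j) (tau x); last first.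
  near=> N; rewrite /q (bz i j jn tj) (min_r tj) (min_r (le_trans tj _)) ?subrr ?mulr0//.
  by rewrite lerDl.
pose e := Num.min (node j.+1) (tau x) - node j.
have e0 : 0 < e by rewrite subr_gt0 lt_min jt andbT; exact: (node_lt hts).
near=> N.
have Ne : N.+1%:R^-1 <= e.
  by near: N; exact: (cvgr_le 0 (@cvg_harmonic R) e e0).
have uN : u N <= Num.min (node j.+1) (tau x) by rewrite /u addrC -lerBrDr.
have uj : u N <= node j.+1 by rewrite (le_trans uN)// ge_min lexx.
have ut : u N <= tau x by rewrite (le_trans uN)// ge_min lexx orbT.
rewrite /q (min_l ut) (min_l (ltW jt)).
have ju : node j <= u N by rewrite lerDl.
rewrite (slope_sum_local (node_incr hts) (b x i) jn (lexx _) ju uj).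
have -> : u N - node j = N.+1%:R^-1 by rewrite /u addrAC subrr add0r.
by rewrite mulrCA divff ?mulr1.
Unshelve. all: by end_near. Qed.

(** By induction on the word, as limits of Riemann sums. *)
Lemma measurable_iterated_integral I v : 0 <= v -> measurable_fun setT
  (fun x => iterated_integral (iota x).2 I (Num.min v (tau x))).
Proof.
elim: I v => [|i I IH] v v0 //.
pose q N x := stopped_riemann_sum (tau x) (iterated_integral (iota x).2 I)
  (slope_sum n node (b x i) id) v N.
have mq N : measurable_fun setT (q N).
  rewrite /q /stopped_riemann_sum; under eq_fun do rewrite big_mkord.
  apply: measurable_sum_ord => k.
  have k0 j : 0 <= j%:R / N.+1%:R * v by rewrite !mulr_ge0.
  apply: measurable_funM; first exact: IH.
  by apply: measurable_funB; exact: measurable_slope_sum.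
apply: (measurable_fun_cvg mq) => x _.
have [/andP[t0 tT] xE _ _] := iota_slopes x.
have Y_slopes k (u : R) : 0 <= u -> u <= tau x -> (iota x).2 u 0 k =
    (iota x).2 0 0 k + slope_sum n node (b x k) id u.
  by move=> u0 ut; rewrite !xE// slope_sum0 ?addr0//; exact: (node_ge0 hts).
have pI := iterated_integral_primitive (node_incr hts) (node_ge0 hts) t0 Y_slopes i I.
have := stopped_riemann_sum_cvg t0 v0 pI.
by rewrite (iterated_integral0 (node_incr hts) (node_ge0 hts) t0 Y_slopes) subr0.
Qed.

End MeasurableSlopes.

(** * Recovering the slopes from the moments *)

Section MomentsGenerate.
Context {R : realType} {d : nat}.
Variables (T : R) (x0 : 'rV[R]_d) (ts : seq R).
Hypothesis T_gt0 : 0 < T.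
Hypothesis hts : itv_partition 0 T ts.
Local Notation n := (size ts).
Local Notation node := (node ts).
Context {disp} {S : measurableType disp}.
Variables (iota : S -> R * (R -> 'rV[R]_(1 + d)))
  (b : S -> 'I_(1 + d) -> nat -> R).
Hypothesis iota_slopes : forall x, slopes_of T x0 ts (iota x) (b x).
Local Notation tau := (fun x => (iota x).1).
Implicit Types (x : S) (i : 'I_(1 + d)) (u v : R).

Let Y_slopes x i u : 0 <= u -> u <= tau x -> (iota x).2 u 0 i =
  (iota x).2 0 0 i + slope_sum n node (b x i) id u.
Proof.
have [/andP[t0 _] xE _ _] := iota_slopes x.
by move=> u0 ut; rewrite !xE// slope_sum0 ?addr0//; exact: (node_ge0 hts).
Qed.

Lemma moment_slope_sum x i k :
  iterated_integral (iota x).2 (i :: nseq k time_index) (tau x) =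
  slope_sum n node (b x i) (fun v => v ^+ k.+1 / k.+1`!%:R) (tau x).
Proof.
have [/andP[t0 _] _ tE _] := iota_slopes x.
by apply: (iterated_integral_moment (node_incr hts) (node_ge0 hts) t0 (Y_slopes (x := x)) tE).
Qed.

Hypothesis moment_measurable : forall i k, measurable_fun setT
  (fun x => iterated_integral (iota x).2 (i :: nseq k time_index) (tau x)).

Lemma measurable_slope_sum_horner i (q : {poly R}) : measurable_fun setT
  (fun x => slope_sum n node (b x i) (fun v => q.[v]) (tau x)).
Proof.
have -> : (fun x => slope_sum n node (b x i) (fun v => q.[v]) (tau x)) =
  (fun x => \sum_(k < size q) q`_k *
    slope_sum n node (b x i) (fun v => v ^+ k) (tau x)).
  apply/funext => x; rewrite /slope_sum.
  under [RHS]eq_bigr do rewrite mulr_sumr.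
  rewrite exchange_big; apply: eq_bigr => j _.
  rewrite !horner_coef -sumrB mulr_sumr; apply: eq_bigr => k _.
  by rewrite -mulrBr mulrCA.
apply: measurable_sum_ord => -[[|k] kq] /=.
  rewrite /slope_sum; under eq_fun do under eq_bigr do rewrite subrr mulr0.
  by under eq_fun do rewrite big1// mulr0; exact: measurable_cst.
apply: measurable_funM; first exact: measurable_cst.
have -> : (fun x => slope_sum n node (b x i) (fun v => v ^+ k.+1) (tau x)) =
  (fun x => k.+1`!%:R *
     iterated_integral (iota x).2 (i :: nseq k time_index) (tau x)).
  apply/funext => x; rewrite moment_slope_sum /slope_sum mulr_sumr.
  apply: eq_bigr => j _; rewrite -mulrBl; field.
  by rewrite pnatr_eq0 -lt0n fact_gt0.
by apply: measurable_funM; [exact: measurable_cst|exact: moment_measurable].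
Qed.

(** The minimum of u and v is (u + v - |v - u|) / 2, and the scale M brings
    v - u into [-1, 1]. *)
Definition min_poly (M u : R) N : {poly R} :=
  2^-1 *: (u%:P + 'X - M *: (abs_poly N \Po (M^-1 *: ('X - u%:P)))).

Lemma min_poly_cvg (M u v : R) : 0 < M -> `|v - u| <= M ->
  (min_poly M u N).[v] @[N --> \oo] --> Num.min u v.
Proof.
move=> M0 vu.
have -> : Num.min u v = 2^-1 * (u + v - M * `|M^-1 * (v - u)|).
  rewrite normrM gtr0_norm ?invr_gt0// mulVKf ?gt_eqF//.
  by case: (leP u v) => h; [rewrite ger0_norm ?subr_ge0|rewrite ltr0_norm ?subr_lt0]; rewrite //; field.
have E N : (min_poly M u N).[v] =
    2^-1 * (u + v - M * (abs_poly N).[M^-1 * (v - u)]).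
  by rewrite /min_poly !(hornerE, horner_comp).
under eq_fun do rewrite E.
apply: cvgM; first exact: cvg_cst.
apply: cvgB; first exact: cvg_cst.
apply: cvgM; first exact: cvg_cst.
apply: abs_poly_cvg; rewrite normrM gtr0_norm ?invr_gt0//.
by rewrite ler_pdivrMl// mulr1.
Qed.

(** The value at time u of the stopped path is the integral of the indicator
    of [0, u] against it, that is, of the derivative of [min u]; approximating
    [min u] by polynomials replaces the indicator by polynomials. *)
Lemma measurable_value_of_moments u i : 0 <= u ->
  measurable_fun setT (fun x => stopped_value (iota x) u i).
Proof.
move=> u0; pose M := T + u.
have M0 : 0 < M by rewrite ltr_pwDl.
have -> : (fun x => stopped_value (iota x) u i) = (fun x =>
    row_mx 0 x0 0 i + slope_sum n node (b x i) (fun v => Num.min u v) (tau x)).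
  apply/funext => x; rewrite (stopped_valueE i (iota_slopes x) u0); congr (_ + _).
  by apply: eq_bigr => j _; rewrite /= ![Num.min u (Num.min _ _)]minCA.
apply: measurable_funD; first exact: measurable_cst.
apply: (measurable_fun_cvg
  (fun N => measurable_slope_sum_horner i (min_poly M u N))) => x _.
rewrite /slope_sum; apply: cvgn_sum_ord => j.
have [/andP[t0 tT] _ _ _] := iota_slopes x.
have nM k : `|Num.min (node k) (tau x) - u| <= M.
  have h0 : 0 <= Num.min (node k) (tau x) by rewrite le_min (node_ge0 hts).
  have hT : Num.min (node k) (tau x) <= T by rewrite ge_min tT orbT.
  by rewrite ler_norml /M; apply/andP; split; lra.
by apply: cvgM; [exact: cvg_cst|apply: cvgB; exact: min_poly_cvg].
Qed.

(** Stopping time and slopes are finitely many measurable coordinates. *)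
Lemma measurable_of_moments (U : set S) :
  (forall x, U x -> exists2 r : R, 0 < r & forall y, `|tau x - tau y| < r ->
     (forall i j, (j < n)%N -> `|b x i j - b y i j| < r) -> U y) ->
  measurable U.
Proof.
move=> Uopen.
have mt := measurable_stopping_time T_gt0 iota_slopes measurable_value_of_moments.
pose Phi (k : option ('I_(1 + d) * 'I_n)) x : R :=
  if k is Some ij then b x ij.1 ij.2 else tau x.
apply: (@measurable_boxes _ _ _ _ Phi).
  move=> [[i j]|] //=.
  exact: (measurable_slope hts iota_slopes measurable_value_of_moments i
    (ltn_ord j)).
move=> x /Uopen[r r0 hr]; exists r => // y hy; apply: hr; first exact: (hy None).
by move=> i j jn; exact: (hy (Some (i, Ordinal jn))).
Qed.

End MomentsGenerate.

(** * Lebesgue norms and monotonicity *)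

Section LnormPowerIntegral.
Context {d} {S : measurableType d} {R : realType}.
Variables (mu : {measure set S -> \bar R}) (p : R).
Hypothesis p1 : 1 <= p.
Implicit Types f g : S -> R.

Let pgt0 : 0 < p. Proof. exact: lt_le_trans p1. Qed.

Lemma LnormE_power_integral f : ('N[mu]_p%:E[EFin \o f] = power_integral mu p f `^ p^-1)%E.
Proof.
by rewrite unlock.
Qed.

Lemma Lnorm_lt_power_integral f (e : R) : 0 < e -> (power_integral mu p f < (e `^ p)%:E)%E ->
  ('N[mu]_p%:E[EFin \o f] < e%:E)%E.
Proof.
move=> e0; rewrite LnormE_power_integral; have := power_integral_ge0 mu p f.
case: (power_integral mu p f) => [r| |] //; rewrite lee_fin lte_fin => r0 re.
rewrite poweR_EFin lte_fin.
have -> : e = (e `^ p) `^ p^-1 by rewrite -powRrM divff ?gt_eqF// powRr1// ltW.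
by rewrite gt0_ltr_powR ?invr_gt0// nnegrE powR_ge0.
Qed.

Lemma Lfun_power_integral f : (f \in Lfun mu p%:E) <->
  measurable_fun setT f /\ (power_integral mu p f < +oo)%E.
Proof.
split=> [/andP[mf lf]|[mf lf]].
  move: mf lf; rewrite !inE/= /finite_norm => mf; split => //.
  have : ('N[mu]_p%:E[EFin \o f] `^ p = power_integral mu p f)%E.
    by rewrite poweR_Lnorm ?gt_eqF.
  move=> <-; have := Lnorm_ge0 mu p%:E (EFin \o f); move: lf.
  by case: (Lnorm _ _ _) => [r _ _| |] //; rewrite poweR_EFin ltry.
apply/andP; split; rewrite inE//= /finite_norm LnormE_power_integral.
move: lf; have := power_integral_ge0 mu p f.
by case: (power_integral mu p f) => [r _ _| |] //; rewrite poweR_EFin ltry.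
Qed.

End LnormPowerIntegral.

(** The integral of a nonnegative function is a supremum over the simple
    functions below it, so monotonicity holds also when the larger function is
    not known to be measurable. *)
Lemma ge0_integral_mono d (S : measurableType d) (R : realType)
    (mu : {measure set S -> \bar R}) (f g : S -> \bar R) :
  (forall x, 0 <= f x)%E -> (forall x, f x <= g x)%E ->
  (\int[mu]_x f x <= \int[mu]_x g x)%E.
Proof.
move=> f0 fg; have g0 x : (0 <= g x)%E by exact: le_trans (fg x).
rewrite !ge0_integralTE//; apply: ereal_sup_le => _ [h hf <-].
exists h => // x; exact: le_trans (hf x) (fg x).
Qed.

(** * Finite combinations of words as signature functionals *)

Section WordSums.
Context {R : realType} {m : nat}.
Implicit Types (Y : R -> 'rV[R]_m) (s r : seq (R * seq 'I_m)) (I J : seq 'I_m).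

Definition word_sum s Y t : R := \sum_(q <- s) q.1 * iterated_integral Y q.2 t.

(** Adding one word enlarges the truncation level to its length; words are
    reversed because signatures read them from the innermost integral. *)
Lemma signature_functional_add_word N (l : seq 'I_m -> R) c I :
  exists N' l', forall Y t, signature_functional N' l' Y t =
    c * iterated_integral Y I t + signature_functional N l Y t.
Proof.
exists (maxn N (size I)).
exists (fun K => (if K == rev I then c else 0) + (if (size K <= N)%N then l K else 0)).
move=> Y t; rewrite /signature_functional.
under eq_bigr do under eq_bigr do rewrite mulrDl.
under eq_bigr do rewrite big_split /=.
rewrite big_split /=; congr (_ + _).
  have kI : (size (rev I) < (maxn N (size I)).+1)%N by rewrite size_rev ltnS leq_maxr.
  rewrite (bigD1 (Ordinal kI))//= [X in _ + X]big1 ?addr0.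
    rewrite (bigD1 (in_tuple (rev I)))//= [X in _ + X]big1 ?addr0.
      by rewrite eqxx /signature revK.
    move=> K; rewrite -val_eqE /= => /negbTE ->; exact: mul0r.
  move=> k; rewrite -val_eqE /= => kneq; apply: big1 => K _.
  case: eqP => [KI|_]; last exact: mul0r.
  by move: kneq; rewrite -KI size_tuple eqxx.
rewrite [RHS](big_ord_widen (maxn N (size I)).+1
  (fun k => \sum_(K : k.-tuple 'I_m) l K * signature Y t K)); last first.
  by rewrite ltnS leq_maxl.
rewrite [RHS]big_mkcond /=; apply: eq_bigr => k _.
rewrite ltnS; case: ifPn => kN; last first.
  by apply: big1 => K _; rewrite size_tuple (negbTE kN) mul0r.
by apply: eq_bigr => K _; rewrite size_tuple kN.
Qed.

Lemma word_sum_signature s : exists N l, forall Y t,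
  signature_functional N l Y t = word_sum s Y t.
Proof.
elim: s => [|[c I] s [N [l IH]]].
  exists 0%N, (fun=> 0) => Y t; rewrite /word_sum big_nil.
  by apply: big1 => k _; apply: big1 => K _; exact: mul0r.
have [N' [l' h]] := signature_functional_add_word N l c I.
by exists N', l' => Y t; rewrite h IH /word_sum big_cons.
Qed.

End WordSums.

(** * Density on the space of stopped paths *)

Lemma pow_le_expR (R : realType) (k : nat) (e : R) : 0 < e ->
  exists2 C : R, 0 <= C & forall v : R, 0 <= v -> v ^+ k <= C * expR (e * v).
Proof.
move=> e0; exists (k`!%:R / e ^+ k); first by rewrite divr_ge0// exprn_ge0// ltW.
move=> v v0; case: k => [|k].
  rewrite expr0 fact0 divr1 mul1r -expR0 ler_expR.
  by rewrite mulr_ge0// ltW.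
have ev0 : 0 <= e * v by rewrite mulr_ge0// ltW.
have f0 : 0 < k.+1`!%:R :> R by rewrite ltr0n fact_gt0.
have ek0 : e ^+ k.+1 != 0 by rewrite gt_eqF// exprn_gt0.
have -> : v ^+ k.+1 = k.+1`!%:R / e ^+ k.+1 * ((e * v) ^+ k.+1 / k.+1`!%:R).
  by rewrite exprMn; field; rewrite ek0 gt_eqF.
rewrite ler_wpM2l ?divr_ge0 ?exprn_ge0 ?(ltW e0)//.
by rewrite (le_trans _ (expR_ge1Dxn k ev0))// lerDr.
Qed.

Section DensityOnStoppedPaths.
Context {R : realType} {d : nat}.
Variables (T : {posnum R}) (x0 : 'rV[R]_d) (ts : seq R) (a : R).
Hypothesis hts : itv_partition 0 T%:num ts.
Hypothesis a_ge0 : 0 <= a.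
Hypothesis a_lt1 : a < 1.
Variables (S : pseudoPMetricType R) (iota : S -> R * (R -> 'rV[R]_(1 + d))).
Hypothesis iota_stopped : forall x, stopped_set T%:num x0 ts (iota x).
Hypothesis iota_ball : forall x (e : R) y,
  ball x e y <-> (stopped_dist T%:num a (iota x) (iota y) < e%:E)%E.
Local Notation n := (size ts).
Local Notation node := (node ts).
Local Notation tau := (fun x => (iota x).1).
Implicit Types (x y : S) (i : 'I_(1 + d)) (u v : R).

Let T_gt0 : 0 < T%:num :> R. Proof. exact: gt0. Qed.

Lemma borel_measurable_lipschitz (f : S -> R) (K : R) : 0 <= K ->
  (forall x y (D : R), (stopped_dist T%:num a (iota x) (iota y) < D%:E)%E ->
     `|f x - f y| <= K * D) ->
  measurable_fun setT (f : borel S -> R).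
Proof.
move=> K0 fK mD; apply: (measurability _ (RGenOInfty.measurableE R)) => //.
move=> /= _ [_ [r ->] <-]; rewrite setTI; apply: sub_sigma_algebra.
rewrite openE => x; rewrite /= in_itv /= andbT => rx.
have K1 : 0 < K + 1 by rewrite ltr_wpDl.
have e0 : 0 < (f x - r) / (K + 1) by rewrite divr_gt0// subr_gt0.
apply/nbhs_ballP; exists ((f x - r) / (K + 1)) => // y /iota_ball/fK.
rewrite /= in_itv /= andbT => h.
have : K * ((f x - r) / (K + 1)) < f x - r.
  by rewrite mulrCA -[ltRHS]mulr1 ltr_pM2l ?subr_gt0// ltr_pdivrMr// mul1r ltrDl.
by have := ler_norm (f x - f y); lra.
Qed.

Let slopes_exist x : exists b, slopes_of T%:num x0 ts (iota x) b.
Proof. exact: (stopped_set_slopes T_gt0 hts (iota_stopped x)). Qed.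

Let b x := projT1 (cid (slopes_exist x)).
Let b_slopes x : slopes_of T%:num x0 ts (iota x) (b x).
Proof. exact: (projT2 (cid (slopes_exist x))). Qed.

Lemma borel_measurable_value u i : 0 <= u ->
  measurable_fun setT ((fun x => stopped_value (iota x) u i) : borel S -> R).
Proof.
move=> u0.
have K0 : 0 <= T%:num `^ a + 1 by rewrite addr_ge0 ?powR_ge0.
have -> : (fun x => stopped_value (iota x) u i) =
    (fun x => stopped_value (iota x) (Num.min u T%:num) i).
  apply/funext => x; have [/andP[_ tT] _ _ _] := b_slopes x.
  by rewrite /stopped_value -minA [Num.min T%:num _]minC (min_l tT).
apply: (borel_measurable_lipschitz K0) => x y D xyD.
apply: (stopped_value_dist T_gt0 hts i a_ge0 (b_slopes x) (b_slopes y) xyD).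
  by rewrite le_min u0 ltW.
by rewrite ge_min lexx orbT.
Qed.

Let Y_slopes x i u : 0 <= u -> u <= tau x -> (iota x).2 u 0 i =
  (iota x).2 0 0 i + slope_sum n node (b x i) id u.
Proof.
have [/andP[t0 _] xE _ _] := b_slopes x.
by move=> u0 ut; rewrite !xE// slope_sum0 ?addr0//; exact: (node_ge0 hts).
Qed.

Lemma borel_measurable_word I : measurable_fun setT
  ((fun x => iterated_integral (iota x).2 I (tau x)) : borel S -> R).
Proof.
have -> : (fun x => iterated_integral (iota x).2 I (tau x)) =
    (fun x => iterated_integral (iota x).2 I (Num.min T%:num (tau x))).
  by apply/funext => x; have [/andP[_ tT] _ _ _] := b_slopes x; rewrite min_r.
exact: (@measurable_iterated_integral _ _ _ _ _ hts _ (borel S) _ _ b_slopes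
  (@borel_measurable_value) I _ (ltW T_gt0)).
Qed.

Definition word_sums : set (S -> R) :=
  [set f | exists s, f = fun x => word_sum s (iota x).2 (tau x)].

Lemma word_sums_word I : word_sums (fun x => iterated_integral (iota x).2 I (tau x)).
Proof.
exists [:: (1, I)]; apply/funext => x.
by rewrite /word_sum big_seq1 mul1r.
Qed.

Lemma word_sumsD f g : word_sums f -> word_sums g ->
  word_sums (fun x => f x + g x).
Proof.
move=> [s ->] [r ->]; exists (s ++ r); apply/funext => x.
by rewrite /word_sum big_cat.
Qed.

Lemma word_sumsZ (c : R) f : word_sums f -> word_sums (fun x => c * f x).
Proof.
move=> [s ->]; exists [seq (c * q.1, q.2) | q <- s]; apply/funext => x.
by rewrite /word_sum big_map mulr_sumr; apply: eq_bigr => q _; rewrite mulrA.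
Qed.

Lemma word_sums_cst (c : R) : word_sums (cst c).
Proof.
exists [:: (c, [::])]; apply/funext => x.
by rewrite /word_sum big_seq1 mulr1.
Qed.

Lemma word_sums_sum (A : Type) (r : seq A) (f : A -> S -> R) :
  (forall q, word_sums (f q)) -> word_sums (fun x => \sum_(q <- r) f q x).
Proof.
move=> hf; elim: r => [|q r IH].
  by under eq_fun do rewrite big_nil; exact: word_sums_cst.
by under eq_fun do rewrite big_cons; exact: (word_sumsD (hf q) IH).
Qed.

(** By bilinearity, the product of two words suffices, and it is a sum of words
    by the shuffle identity. *)
Lemma word_sumsM f g : word_sums f -> word_sums g ->
  word_sums (fun x => f x * g x).
Proof.
move=> [s ->] [r ->]; rewrite /word_sum.
under eq_fun do rewrite mulr_suml.
apply: word_sums_sum => q; under eq_fun do rewrite mulr_sumr.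
apply: word_sums_sum => q'.
have -> : (fun x => q.1 * iterated_integral (iota x).2 q.2 (tau x) *
      (q'.1 * iterated_integral (iota x).2 q'.2 (tau x))) =
    (fun x => (q.1 * q'.1) * \sum_(K <- shuffle q.2 q'.2)
      iterated_integral (iota x).2 K (tau x)).
  apply/funext => x; have [/andP[t0 _] _ _ _] := b_slopes x.
  rewrite -(iterated_integralM (node_incr hts) (node_ge0 hts) t0 (Y_slopes (x := x)))//.
  by ring.
by apply: word_sumsZ; apply: word_sums_sum => K; exact: word_sums_word.
Qed.

Lemma word_sums_measurable f : word_sums f ->
  measurable_fun setT (f : borel S -> R).
Proof.
move=> [s ->]; rewrite /word_sum; elim: s => [|q s IH].
  by under eq_fun do rewrite big_nil; exact: measurable_cst.
under eq_fun do rewrite big_cons; apply: measurable_funD => //.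
by apply: measurable_funM => //; exact: borel_measurable_word.
Qed.

Let variation x : R := 1 + \sum_(i < 1 + d) slope_variation n node (b x i) (tau x).

Let slope_variation_tau_ge0 x i : 0 <= slope_variation n node (b x i) (tau x).
Proof.
have [/andP[t0 _] _ _ _] := b_slopes x.
exact: (slope_variation_ge0 (node_incr hts) (node_ge0 hts)).
Qed.

Let slope_variation_le x i : slope_variation n node (b x i) (tau x) <= variation x.
Proof.
rewrite /variation (bigD1 i)//= addrCA lerDl addr_ge0//.
by apply: sumr_ge0 => k _.
Qed.

Let variation_ge1 x : 1 <= variation x.
Proof. by rewrite /variation lerDl; apply: sumr_ge0 => i _. Qed.

Let variation_measurable : measurable_fun setT (variation : borel S -> R).
Proof.
apply: measurable_funD; first exact: measurable_cst.
apply: measurable_sum_ord => i; rewrite /slope_variation /slope_sum.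
apply: measurable_sum_ord => j.
have mt := measurable_stopping_time T_gt0 (S := borel S) b_slopes (@borel_measurable_value).
apply: measurable_funM.
  apply: (measurableT_comp (@normr_measurable R setT)).
  exact: (measurable_slope (S := borel S) hts b_slopes (@borel_measurable_value) i (ltn_ord j)).
by apply: measurable_funB; apply: measurable_minr => //; exact: measurable_cst.
Qed.

Lemma word_le_variation x I : `|iterated_integral (iota x).2 I (tau x)| <= variation x ^+ size I.
Proof.
have [/andP[t0 _] _ _ _] := b_slopes x.
by apply: (iterated_integral_le (node_incr hts) (node_ge0 hts) t0
  (Y_slopes (x := x)) I (slope_variation_le x)).
Qed.

(** Polynomial growth in the variation is subexponential. *)
Lemma word_sums_growth f (k : R) : 0 < k -> word_sums f -> forall e : R, 0 < e ->
  exists2 C : R, 0 <= C & forall x, `|f x| <= C * expR (e * (k * variation x)).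
Proof.
move=> k0 [s ->] e e0; elim: s => [|q s [C C0 hC]].
  by exists 0 => // x; rewrite /word_sum big_nil normr0 mul0r.
have [D D0 hD] := pow_le_expR (size q.2) (mulr_gt0 e0 k0).
exists (`|q.1| * D + C); first by rewrite addr_ge0// mulr_ge0.
move=> x; rewrite /word_sum big_cons (le_trans (ler_normD _ _))//.
rewrite [leRHS]mulrDl lerD//; last exact: hC.
rewrite normrM -mulrA ler_wpM2l// (le_trans (word_le_variation x q.2))// mulrA.
by apply: hD; apply: le_trans (variation_ge1 x).
Qed.

(** Up to a constant, the integral of the k-th power of time against
    coordinate i; for k = 0 and the time coordinate, it is the stopping time. *)
Definition moments : set (S -> R) := [set f | exists i k, f = fun x =>
  iterated_integral (iota x).2 (i :: nseq k time_index) (tau x)].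

(** Unlike general words, moments are linear in the path, hence bounded by a
    multiple of the variation; sines of them are therefore multipliers. *)
Lemma moments_growth f (k : R) : 0 < k -> moments f ->
  exists C : R, forall x, `|f x| <= C * (k * variation x).
Proof.
move=> k0 [i [l ->]]; exists (T%:num ^+ l / l`!%:R / k) => x.
have [/andP[t0 tT] _ tE _] := b_slopes x.
have hT u : 0 <= u -> u <= tau x ->
    `|iterated_integral (iota x).2 (nseq l time_index) u| <= T%:num ^+ l / l`!%:R.
  move=> u0 ut.
  rewrite (iterated_integral_time (node_incr hts) (node_ge0 hts) t0 (Y_slopes (x := x)) tE)//.
  rewrite ger0_norm ?divr_ge0 ?exprn_ge0// ler_wpM2r ?invr_ge0//.
  by rewrite lerXn2r ?nnegrE// ?(le_trans ut)// ltW.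
have pS := iterated_integral_primitive (node_incr hts) (node_ge0 hts) t0
  (Y_slopes (x := x)) i (nseq l time_index).
have := primitive_le_variation (node_incr hts) (node_ge0 hts) pS hT t0 (lexx _).
rewrite (iterated_integral0 (node_incr hts) (node_ge0 hts) t0 (Y_slopes (x := x))) subr0.
move=> /le_trans; apply.
by rewrite [leRHS]mulrA divfK ?gt_eqF// ler_wpM2l// divr_ge0// exprn_ge0.
Qed.

Lemma moments_generate (Sigma : set (set S)) : sigma_algebra setT Sigma ->
  (forall f, moments f -> measurable_fun setT (f : g_sigma_algebraType Sigma -> R)) ->
  forall A : set (borel S), measurable A -> Sigma A.
Proof.
move=> sS mS; suff oS : @open S `<=` Sigma.
  by apply: smallest_sub => //.
move=> U Uo.
have SE : @measurable _ (g_sigma_algebraType Sigma) = Sigma by exact: sigma_algebra_id.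
rewrite -SE.
apply: (measurable_of_moments (S := g_sigma_algebraType Sigma) T_gt0 hts b_slopes).
  by move=> i k; apply: mS; exists i, k.
move=> x Ux; have : nbhs x U by exact: open_nbhs_nbhs.
move=> /nbhs_ballP[e /= e0 xU].
have [r r0 hr] := stopped_dist_lt_slopes T_gt0 hts a_ge0 a_lt1 (b_slopes x) e0.
exists r => // y ty by_; apply: xU; apply/iota_ball; exact: (hr _ _ (b_slopes y)).
Qed.

Section ExponentialWeight.
Variables (alpha beta gamma p : R) (nu : {measure set (borel S) -> \bar R}).
Hypothesis alpha_ge0 : 0 <= alpha.
Hypothesis beta_gt0 : 0 < beta.
Hypothesis gamma_ge1 : 1 <= gamma.
Hypothesis p_ge1 : 1 <= p.
Hypothesis weight_integrable : (\int[nu]_x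
  (exp_weight T alpha beta gamma (stopped_path (iota x)) `^ p) < +oo)%E.

Let rate : R := beta / ((1 + d)%:R * n%:R * T%:num `^ alpha + 1).

Let rate_gt0 : 0 < rate.
Proof. by rewrite divr_gt0// ltr_wpDl// mulr_ge0 ?powR_ge0// mulr_ge0. Qed.

(** Since k <= 1 + k ^ gamma, the weight controls an exponential of the Hoelder
    norm itself, and the variation is at most linear in that norm. *)
Lemma expR_variation_le_weight x :
  ((`|expR (- (rate + beta)) * expR (rate * variation x)| `^ p)%:E <=
   exp_weight T alpha beta gamma (stopped_path (iota x)) `^ p)%E.
Proof.
have p0 : p != 0 by rewrite gt_eqF// (lt_le_trans _ p_ge1).
have g0 : gamma != 0 by rewrite gt_eqF// (lt_le_trans _ gamma_ge1).
have := holder_norm_ge0 alpha (stopped_path (iota x)) T_gt0.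
rewrite /exp_weight; case E : holder_norm => [k| |] // k0; last first.
  by rewrite poweRyr// gt0_muley ?lte_fin// poweRyr// leey.
have -> : (expeR (beta%:E * k%:E `^ gamma) `^ p)%E =
  (expR (beta * k `^ gamma) `^ p)%:E by [].
rewrite lee_fin; rewrite lee_fin in k0.
rewrite ge0_ler_powR ?nnegrE ?expR_ge0 ?(le_trans _ p_ge1)//.
rewrite ger0_norm -?expRD ?expR_ge0// ler_expR.
have kg : k <= 1 + k `^ gamma.
  have [k1|k1] := leP k 1; first by rewrite (le_trans k1)// lerDl powR_ge0.
  rewrite (@le_trans _ _ (k `^ gamma)) ?lerDr// -{1}[k]powRr1//.
  by rewrite ler_powR// ltW.
have Vk : variation x <= 1 + (1 + d)%:R * n%:R * T%:num `^ alpha * k.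
  rewrite /variation lerD2l.
  apply: (@le_trans _ _ (\sum_(i < 1 + d) n%:R * (T%:num `^ alpha * k))).
    apply: ler_sum => i _.
    by apply: (slope_variation_holder T_gt0 hts i (b_slopes x) alpha_ge0); rewrite E.
  by rewrite sumr_const card_ord -[leLHS]mulr_natl !mulrA.
have rate_le : rate * ((1 + d)%:R * n%:R * T%:num `^ alpha) <= beta.
  have D0 : 0 <= (1 + d)%:R * n%:R * T%:num `^ alpha by rewrite mulr_ge0 ?powR_ge0.
  rewrite /rate mulrAC ler_pdivrMr; last by rewrite ltr_wpDl.
  by rewrite ler_wpM2l ?(ltW beta_gt0)// lerDl.
have rk : rate * variation x <= rate + beta * k.
  rewrite (le_trans (ler_wpM2l (ltW rate_gt0) Vk))// mulrDr mulr1 lerD2l mulrA.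
  by rewrite ler_wpM2r.
have := ler_wpM2l (ltW beta_gt0) kg; rewrite mulrDr mulr1.
lra.
Qed.

Theorem word_sums_dense f : f \in Lfun nu p%:E -> forall eps : R, 0 < eps ->
  exists2 fl, word_sums fl &
    fl \in Lfun nu p%:E /\ ('N[nu]_p%:E[EFin \o (f \- fl)%R] < eps%:E)%E.
Proof.
move=> /(Lfun_power_integral nu p_ge1)[mf fp] eps eps0.
pose V x := rate * variation x.
have mV : measurable_fun setT (V : borel S -> R).
  by apply: measurable_funM => //; exact: measurable_cst.
have V_ge0 x : 0 <= V x.
  by rewrite /V mulr_ge0 ?(ltW rate_gt0) ?(le_trans _ (variation_ge1 x)).
have mexp : measurable_fun setT (expR \o V : borel S -> R) by exact: measurableT_comp.
have V_int : (power_integral nu p (expR \o V) < +oo)%E.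
  have : (power_integral nu p (fun x => expR (- (rate + beta)) * (expR \o V) x)%R < +oo)%E.
    apply: le_lt_trans weight_integrable; apply: ge0_integral_mono => x.
      by rewrite lee_fin powR_ge0.
    exact: expR_variation_le_weight.
  rewrite (power_integral_scale nu p _ mexp) => h.
  have c0 : 0 < `|expR (- (rate + beta))| `^ p.
    by rewrite powR_gt0// normr_gt0 gt_eqF// expR_gt0.
  move: h; have := power_integral_ge0 nu p (expR \o V).
  case: (power_integral nu p (expR \o V)) => [r _ _| |]//; first by rewrite ltry.
  by rewrite gt0_muley ?lte_fin// ltxx.
have mL : moments `<=` word_sums.
  by move=> _ [i [k ->]]; exact: word_sums_word.
have [mf' af] := @generated_algebra_dense _ (borel S) _ nu p p_ge1 word_sums V
  word_sums_measurable word_sums_cst word_sumsD word_sumsM mV V_ge0 V_int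
  (fun h Lh => @word_sums_growth h rate rate_gt0 Lh) moments
  mL (fun g Gg => moments_growth rate_gt0 Gg) moments_generate f mf fp.
have [fl Lfl ffl] := af _ (powR_gt0 p eps0).
have mfl := word_sums_measurable Lfl.
exists fl => //; split; last exact: (Lnorm_lt_power_integral p_ge1 eps0 ffl).
apply/(Lfun_power_integral nu p_ge1); split; first exact: mfl.
have [C C0 hC] := word_sums_growth rate_gt0 Lfl ltr01.
apply: (power_integral_growth_lty p_ge1 mV V_int mfl (C := C)) => x.
by have := hC x; rewrite mul1r.
Qed.

End ExponentialWeight.

End DensityOnStoppedPaths.

(** * Paths on the whole interval *)

Lemma eq_holder_norm (R : realType) m (T a : R) (Y Z : R -> 'rV[R]_m) :
  (forall u, 0 <= u -> u <= T -> Y u = Z u) ->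
  holder_norm T a Y = holder_norm T a Z.
Proof.
move=> YZ; congr ereal_sup; apply: eq_imagel => -[x y] /= [x0 xy yT].
by rewrite !YZ// ?(le_trans x0) ?(le_trans _ yT)// ltW.
Qed.

Section FullPaths.
Context {R : realType} {d : nat}.
Variables (T : R) (x0 : 'rV[R]_d) (ts : seq R).
Hypothesis T_ge0 : 0 <= T.
Implicit Types (Y Z : R -> 'rV[R]_(1 + d)).

(** This embeds the paths isometrically into the stopped paths, so that a single
    density theorem covers both parts. *)
Lemma path_set_stopped Y : path_set T x0 ts Y -> stopped_set T x0 ts (T, Y).
Proof.
move=> pY; split; first by rewrite /= T_ge0 lexx.
exists Y => //=; have [X _ ->] := pY; apply/funext => u.
by rewrite /patch; case: ifPn.
Qed.

Lemma stopped_path_full Y u : path_set T x0 ts Y -> 0 <= u -> u <= T ->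
  stopped_path (T, Y) u = Y u.
Proof.
move=> [X _ ->] u0 uT; rewrite /stopped_path /= (min_l uT) /patch mem_set.
  by rewrite /time_extend row_mxKr.
by rewrite /= in_itv /= u0.
Qed.

Lemma stopped_dist_full a Y Z : path_set T x0 ts Y -> path_set T x0 ts Z ->
  stopped_dist T a (T, Y) (T, Z) = holder_dist T a Y Z.
Proof.
move=> pY pZ; rewrite /stopped_dist /= subrr normr0 add0e.
by apply: eq_holder_norm => u u0 uT /=; rewrite !stopped_path_full.
Qed.

End FullPaths.

Theorem theorem3p4 (R : realType) (T : {posnum R}) (d : nat) (x0 : 'rV[R]_d)
    (ts : seq R) (alpha' alpha beta gamma p : R) (hd : (0 < d)%N)
    (hts : itv_partition 0 T%:num ts)
    (halpha'0 : 0 <= alpha') (halpha' : alpha' < alpha) (halpha : alpha <= 1)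
    (hbeta : 0 < beta) (hgamma : 1 <= gamma) (hp : 1 <= p) :
  (forall nu : {finite_measure set (borel (path_space T x0 ts alpha')) -> \bar R},
    (\int[nu]_Y (exp_weight T alpha beta gamma (sval Y) `^ p) < +oo)%E ->
    forall f : path_space T x0 ts alpha' -> R, f \in Lfun nu p%:E ->
    forall eps : R, 0 < eps ->
    exists2 fl : path_space T x0 ts alpha' -> R,
      path_functionals fl &
      fl \in Lfun nu p%:E /\ ('N[nu]_p%:E[EFin \o (f \- fl)%R] < eps%:E)%E)
  /\
  (forall nu : {finite_measure set (borel (stopped_space T x0 ts alpha')) -> \bar R},
    (\int[nu]_w (exp_weight T alpha beta gamma (stopped_path (sval w)) `^ p)
      < +oo)%E ->
    forall f : stopped_space T x0 ts alpha' -> R, f \in Lfun nu p%:E ->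
    forall eps : R, 0 < eps ->
    exists2 fl : stopped_space T x0 ts alpha' -> R,
      stopped_functionals fl &
      fl \in Lfun nu p%:E /\ ('N[nu]_p%:E[EFin \o (f \- fl)%R] < eps%:E)%E).
Proof.
have alpha'1 : alpha' < 1 by exact: lt_le_trans halpha.
have alpha0 : 0 <= alpha by rewrite (le_trans halpha'0)// ltW.
split=> nu nu_int f fp eps eps0.
- pose S := path_space T x0 ts alpha'.
  pose iota (Y : S) := (T%:num, sval Y).
  have inP (Y : S) : path_set T%:num x0 ts (sval Y) := set_mem (svalP Y).
  have iota_stopped (Y : S) : stopped_set T%:num x0 ts (iota Y).
    by apply: path_set_stopped; [exact: ge0|exact: inP].
  have iota_ball (Y : S) (e : R) (Z : S) : ball Y e Z <->
      (stopped_dist T%:num alpha' (iota Y) (iota Z) < e%:E)%E.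
    by rewrite (stopped_dist_full _ (inP Y) (inP Z)).
  have weight : (\int[nu]_Y (exp_weight T alpha beta gamma
      (stopped_path (iota Y)) `^ p) < +oo)%E.
    apply: le_lt_trans nu_int; rewrite le_eqVlt; apply/orP; left; apply/eqP.
    apply: eq_integral => Y _; congr (expeR (_ * _ `^ _) `^ _)%E.
    apply: eq_holder_norm => u u0 uT; apply: stopped_path_full u0 uT.
    exact: inP.
  have [fl [s flE] flP] := word_sums_dense hts halpha'0 alpha'1 iota_stopped
    iota_ball alpha0 hbeta hgamma hp weight fp eps0.
  exists fl => //; have [N [l Nl]] := word_sum_signature s.
  by exists N, l; rewrite flE; apply/funext => Y; rewrite Nl.
- pose S := stopped_space T x0 ts alpha'.
  have inP (w : S) : stopped_set T%:num x0 ts (sval w) := set_mem (svalP w).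
  have iota_ball (w : S) (e : R) (v : S) : ball w e v <->
      (stopped_dist T%:num alpha' (sval w) (sval v) < e%:E)%E by [].
  have [fl [s flE] flP] := word_sums_dense hts halpha'0 alpha'1 inP
    iota_ball alpha0 hbeta hgamma hp nu_int fp eps0.
  exists fl => //; have [N [l Nl]] := word_sum_signature s.
  by exists N, l; rewrite flE; apply/funext => w; rewrite Nl.
Qed.
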